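(* The set $$\Sigma_2=\{r=r_s/2,\ p_t+\Psi=0\}\subset\dot T^*M$$ (including its points over the poles, $\{r=r_s/2,\ \theta=m\pi,\ p_\phi=0,\ p_t=0\}$) equals the set of double characteristic points of $P$.
   Context: Let $r_s>0$ be the Schwarzschild radius, $c>0$ the speed of light, and $a=r_s/2$ (the extremal case). $(M,g)$ is the extremal Kerr black hole spacetime, described in Boyer-Lindquist coordinates $(t,r,\theta,\phi)$, with $(p_t,p_r,p_\theta,p_\phi)$ the dual momentum coordinates. Put $\Sigma=r^2+a^2\cos^2\theta$ and $\Delta=r^2-r_sr+a^2=(r-r_s/2)^2$. The ring singularity $\{\Sigma=0\}=\{r=0,\ \theta=\pi/2\}$ is excluded from $M$. $M$ contains the event horizon $\{r=r_s/2\}$ and the two blocks $\{r>r_s/2\}$ and $\{r<r_s/2\}$ on either side of it. The rotation axis is the set $\{\theta=n\pi\}$, and the covectors over it are identified with $\{\theta=n\pi,\ p_\phi=0\}$. The metric $g$ is given by its inverse $$g^{\mu\nu}p_\mu p_\nu=-\frac1{c^2\Delta}\Big(r^2+a^2+\frac{r_sr}{\Sigma}a^2\sin^2\theta\Big)p_t^2-\frac{2a}{c\Delta}\frac{r_sr}{\Sigma}p_\phi p_t+\frac{\Delta}{\Sigma}p_r^2+\frac1\Sigma p_\theta^2+\frac1{\Delta\sin^2\theta}\Big(1-\frac{r_sr}\Sigma\Big)p_\phi^2,$$ with volume density $\sqrt{-\det g}=\Sigma\sin\theta$ in these coordinates. $\dot T^*M$ is the cotangent bundle minus the zero section. The operator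 is $P=\Delta\,\square_g+\kappa$, where $\kappa\in C^\infty(M)$ and $\square_gu=\frac1{\sqrt{-\det g}}\partial_\mu(\sqrt{-\det g}\,g^{\mu\nu}\partial_\nu u)$. It has smooth coefficients on the whole of $M$, including across the horizon, and its principal symbol is $-\Delta g^{\mu\nu}p_\mu p_\nu$ up to multiplication by the non-vanishing volume density, extended smoothly across $r=r_s/2$ and the axis. The function $\Psi$ is $$\Psi:=\frac{g^{t\phi}}{g^{tt}}p_\phi=\frac{ac}{r^2+a^2+\frac{r_sr}{\Sigma}a^2\sin^2\theta}\,\frac{r_sr}{\Sigma}\,p_\phi,$$ which extends smoothly over the axis, where $p_\phi=0$ and hence $\Psi=0$. A covector $\lambda\in\dot T^*M$ is a double characteristic point of a pseudo-differential operator $R$ if $\rho(\lambda)=0$ and $d\rho(\lambda)=0$, where $\rho$ is the principal symbol of $R$ near $\lambda$. *)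

(* Defs.v *)
From Stdlib Require Import Reals Lra.
From Coquelicot Require Import Coquelicot.
Set Implicit Arguments.
Open Scope R_scope.

Inductive coord := c0 | c1 | c2 | c3.

Definition coord_eq_dec (i j : coord) : {i = j} + {i <> j}.
Proof. decide equality. Defined.

(* Topologized by Coquelicot's uniform structure on functions, i.e. by the sup norm. *)
Definition vec := coord -> R.

Definition upd (x : vec) (m : coord) (s : R) : vec :=
  fun n => if coord_eq_dec n m then s else x n.

Definition pd (m : coord) (f : vec -> R) (x : vec) : R :=
  Derive (fun s => f (upd x m s)) (x m).

Definition pdC (m : coord) (f : vec -> C) (x : vec) : C :=
  (pd m (fun y => Re (f y)) x, pd m (fun y => Im (f y)) x).

Fixpoint Ck (k : nat) (U : vec -> Prop) (f : vec -> R) : Prop :=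
  (forall x, U x -> continuous f x) /\
  match k with
  | O => True
  | S k' => forall m,
      (forall x, U x -> ex_derive (fun s => f (upd x m s)) (x m)) /\
      Ck k' U (pd m f)
  end.

Definition smooth (U : vec -> Prop) (f : vec -> R) : Prop :=
  forall k, Ck k U f.

Definition smoothC (U : vec -> Prop) (f : vec -> C) : Prop :=
  smooth U (fun x => Re (f x)) /\ smooth U (fun x => Im (f x)).

Definition sumC (f : coord -> C) : C := (f c0 + f c1 + f c2 + f c3)%C.

Record diffop := Diffop {
  coef2 : coord -> coord -> vec -> C;
  coef1 : coord -> vec -> C;
  coef0 : vec -> C }.

Definition smooth_coefs (U : vec -> Prop) (L : diffop) : Prop :=
  (forall m n, smoothC U (coef2 L m n)) /\
  (forall m, smoothC U (coef1 L m)) /\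
  smoothC U (coef0 L).

Definition apply_diffop (L : diffop) (u : vec -> C) (x : vec) : C :=
  (sumC (fun m => sumC (fun n => coef2 L m n x * pdC m (pdC n u) x))
   + sumC (fun m => coef1 L m x * pdC m u x)
   + coef0 L x * u x)%C.

Definition principal_symbol (L : diffop) (x p : vec) : C :=
  sumC (fun m => sumC (fun n =>
    coef2 L m n x * (Ci * RtoC (p m)) * (Ci * RtoC (p n))))%C.

(* M is realized in R x R x S^2, with S^2 the unit sphere of R^3: a point is
   (t, r, omega), where the Boyer-Lindquist angles are given by
   omega = (sin theta cos phi, sin theta sin phi, cos theta).  The rotation axis
   is omega_x = omega_y = 0, and r ranges over all of R. *)
Inductive amb := At | Ar | Ax | Ay | Az.

Definition point := amb -> R.

Definition cos2 (q : point) : R := (q Az)^2.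
Definition sin2 (q : point) : R := (q Ax)^2 + (q Ay)^2.

Section Kerr.
Variables rs c : R.

Definition spin : R := rs / 2.

Definition Sigma (q : point) : R := (q Ar)^2 + spin^2 * cos2 q.
Definition Delta (q : point) : R := (q Ar)^2 - rs * q Ar + spin^2.

Definition in_M (q : point) : Prop :=
  sin2 q + cos2 q = 1 /\ Sigma q <> 0.

(* Near the poles, (x, y) = (omega_x, omega_y) are smooth coordinates of M. *)
Inductive chart := BL | North | South.

Definition par (X : chart) (x : vec) : point := fun i =>
  match X, i with
  | _, At => x c0
  | _, Ar => x c1
  | BL, Ax => sin (x c2) * cos (x c3)
  | BL, Ay => sin (x c2) * sin (x c3)
  | BL, Az => cos (x c2)
  | _, Ax => x c2
  | _, Ay => x c3
  | North, Az => sqrt (1 - (x c2)^2 - (x c3)^2)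
  | South, Az => - sqrt (1 - (x c2)^2 - (x c3)^2)
  end.

(* In the chart BL the angle phi ranges over R: [par BL] is a local
   diffeomorphism, 2 PI-periodic in phi, onto M minus the axis. *)
Definition dom (X : chart) (x : vec) : Prop :=
  in_M (par X x) /\
  match X with
  | BL => 0 < x c2 < PI
  | _ => (x c2)^2 + (x c3)^2 < 1
  end.

Definition smoothM (u : point -> C) : Prop :=
  forall X, smoothC (dom X) (fun x => u (par X x)).

(* A covector at (t, r, omega) is represented by the ambient covector
   (p_t, p_r, eta) with eta orthogonal to omega; its action on tangent vectors
   is the restriction of the ambient pairing. *)
Record covector := Covector { base : point; mom : amb -> R }.

Definition in_TM (l : covector) : Prop :=
  in_M (base l) /\
  mom l Ax * base l Ax + mom l Ay * base l Ay + mom l Az * base l Az = 0.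

Definition in_TM0 (l : covector) : Prop :=
  in_TM l /\ exists i, mom l i <> 0.

(* p_m is the value of the covector l on the m-th coordinate vector field. *)
Definition has_coords (X : chart) (l : covector) (x p : vec) : Prop :=
  dom X x /\ base l = par X x /\
  forall m, p m =
    mom l At * pd m (fun y => par X y At) x +
    mom l Ar * pd m (fun y => par X y Ar) x +
    mom l Ax * pd m (fun y => par X y Ax) x +
    mom l Ay * pd m (fun y => par X y Ay) x +
    mom l Az * pd m (fun y => par X y Az) x.

Definition operator := (point -> C) -> (point -> C).

Definition local_expr (Q : operator) (X : chart) (L : diffop) : Prop :=
  smooth_coefs (dom X) L /\
  forall u, smoothM u -> forall x, dom X x ->
    Q u (par X x) = apply_diffop L (fun y => u (par X y)) x.

(* The double characteristic points in the cotangent bundle minus its zero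
   section, for an operator Q of order 2.  The conditions are invariant under
   changes of coordinates, so it does not matter which chart is used. *)
Definition double_char (Q : operator) (l : covector) : Prop :=
  in_TM0 l /\
  exists X L x p,
    local_expr Q X L /\ has_coords X l x p /\
    principal_symbol L x p = 0 /\
    (forall m, pdC m (fun y => principal_symbol L y p) x = 0) /\
    (forall m, pdC m (fun y => principal_symbol L x y) p = 0).

(* In Boyer-Lindquist coordinates x = (t, r, theta, phi). *)
Definition ginv (m n : coord) (x : vec) : R :=
  let q := par BL x in
  let r := x c1 in
  let th := x c2 in
  match m, n with
  | c0, c0 => - / (c^2 * Delta q)
                * (r^2 + spin^2 + rs * r / Sigma q * spin^2 * (sin th)^2)
  | c0, c3 | c3, c0 => - (spin / (c * Delta q)) * (rs * r / Sigma q)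
  | c1, c1 => Delta q / Sigma q
  | c2, c2 => / Sigma q
  | c3, c3 => / (Delta q * (sin th)^2) * (1 - rs * r / Sigma q)
  | _, _ => 0
  end.

Definition vol (x : vec) : R := Sigma (par BL x) * sin (x c2).

Definition box (u : vec -> C) (x : vec) : C :=
  (RtoC (/ vol x) * sumC (fun m => sumC (fun n =>
     pdC m (fun y => RtoC (vol y * ginv m n y) * pdC n u y) x)))%C.

(* Q is the operator Delta box_g + kappa, extended smoothly across the horizon
   (where ginv is singular) and the axis (not covered by BL).  As the remaining
   points are dense, this determines Q u on M for all smooth u. *)
Definition is_Delta_box_plus (kappa : point -> C) (Q : operator) : Prop :=
  forall u, smoothM u ->
    smoothM (Q u) /\
    forall x, dom BL x -> Delta (par BL x) <> 0 ->
      Q u (par BL x) =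
        (RtoC (Delta (par BL x)) * box (fun y => u (par BL y)) x
         + kappa (par BL x) * u (par BL x))%C.

(* p_phi on all of T*M: the value of the covector on the rotation field
   (0, 0, - omega_y, omega_x, 0), which is d/dphi and vanishes on the axis. *)
Definition p_phi (l : covector) : R :=
  base l Ax * mom l Ay - base l Ay * mom l Ax.

Definition Psi (l : covector) : R :=
  let q := base l in
  let r := q Ar in
  spin * c / (r^2 + spin^2 + rs * r / Sigma q * spin^2 * sin2 q)
    * (rs * r / Sigma q) * p_phi l.

Lemma p_phi_BL l x p : has_coords BL l x p -> p_phi l = p c3.
Proof.
intros [_ [Hb Hp]].
rewrite (Hp c3); unfold p_phi, pd; rewrite Hb; cbn.
assert (H1 : Derive (fun _ : R => x c0) (x c3) = 0) by apply Derive_const.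
assert (H2 : Derive (fun _ : R => x c1) (x c3) = 0) by apply Derive_const.
assert (H3 : Derive (fun s => sin (x c2) * cos s) (x c3)
             = - (sin (x c2) * sin (x c3))).
{ apply is_derive_unique; auto_derive; [trivial | ring]. }
assert (H4 : Derive (fun s => sin (x c2) * sin s) (x c3)
             = sin (x c2) * cos (x c3)).
{ apply is_derive_unique; auto_derive; [trivial | ring]. }
assert (H5 : Derive (fun _ : R => cos (x c2)) (x c3) = 0) by apply Derive_const.
unfold upd; cbn.
rewrite H1, H2, H3, H4, H5; ring.
Qed.

Lemma Psi_BL l x p : c <> 0 -> has_coords BL l x p ->
  Delta (base l) <> 0 -> ginv c0 c0 x <> 0 ->
  Psi l = ginv c0 c3 x / ginv c0 c0 x * p c3.
Proof.
intros Hc Hx HD Hg.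
pose proof (p_phi_BL Hx) as Hphi.
destruct Hx as [[[_ HS] _] [Hb _]].
unfold Psi; rewrite Hphi, Hb; rewrite Hb in HD.
assert (Hs : sin2 (par BL x) = (sin (x c2))^2).
{ unfold sin2; cbn.
  transitivity ((sin (x c2))^2 * (Rsqr (sin (x c3)) + Rsqr (cos (x c3)))).
  - unfold Rsqr; ring.
  - rewrite sin2_cos2; ring. }
rewrite Hs.
revert Hg HS HD; unfold ginv.
change (par BL x Ar) with (x c1).
set (A := (x c1)^2 + spin^2 + _); set (D := Delta _); set (S := Sigma _).
intros Hg HS HD.
assert (HA : A <> 0) by (intro E; apply Hg; rewrite E; ring).
field; repeat split; assumption.
Qed.

Definition Sigma2 (l : covector) : Prop :=
  in_TM0 l /\ base l Ar = rs / 2 /\ mom l At + Psi l = 0.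

End Kerr.

(* Main.v *)
(* With a = rs/2, the symbol of P is minus
     (1/Sigma) (- W^2/c^2 + Delta (E + Delta p_r^2)),
   where W = (r^2+a^2) p_t + a c p_phi and
   E = p_theta^2 + (a sin(theta) p_t / c + p_phi / sin(theta))^2.  On the horizon
   Delta = (r-a)^2 vanishes to second order and W = 2 a^2 (p_t + Psi), so the
   symbol vanishes there exactly where p_t + Psi does, and then to second order.
   Off the horizon the quadratic form is nondegenerate, so its differential in p
   vanishes only on the zero section.
     An operator with coefficients smooth across the horizon and the axis, equal
   to P by density, is written down in each chart.  Any other local expression of
   P has the same symbol, as the Leibniz defect P(gh) - g P h - h P g + g h P 1
   of products of linear functions of the ambient coordinates shows. *)

From Stdlib Require Import Reals Lra FunctionalExtensionality.
From Coquelicot Require Import Coquelicot.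
Require Import Defs.
Open Scope R_scope.

(** * Partial derivatives and smoothness *)

(** [double_char] asks for some chart and some local expression, so the converse faces an arbitrary
    [L], whose coefficients may be complex and not symmetric. Only their symmetrization is
    determined by [P], and that is what [polar2] records. Test functions have to be smooth on all of
    [M]. The angles are not, but linear functions of [(t, r, omega)] are, and by [has_coords] the
    momentum of every covector is the pullback of such a constant differential. The quadratic form
    is therefore also written on ambient covectors, as [amb_form]. This serves twice: the
    second-order coefficients of two charts are compared without inverting a Jacobian, and
    nondegeneracy is checked without any chart. Both directions rest on a local expression of [P] in
    every chart, whereas [P] is prescribed only in [BL] and off the horizon. The polar charts are
    reached through the explicit map [trans]; there the first-order coefficients are recognized as
    the values of the operator on the coordinate functions. *)

Lemma upd_at (x : vec) m s : upd x m s m = s.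
Proof. unfold upd; destruct (coord_eq_dec m m); congruence. Qed.

Lemma upd_id (x : vec) m : upd x m (x m) = x.
Proof.
apply functional_extensionality; intro n; unfold upd.
destruct (coord_eq_dec n m); congruence.
Qed.

Lemma upd_upd (x : vec) m s s' : upd (upd x m s) m s' = upd x m s'.
Proof.
apply functional_extensionality; intro n; unfold upd.
destruct (coord_eq_dec n m); congruence.
Qed.

Definition is_pd (m : coord) (f : vec -> R) (x : vec) (l : R) : Prop :=
  is_derive (fun s => f (upd x m s)) (x m) l.

Lemma is_pd_unique m f x l : is_pd m f x l -> pd m f x = l.
Proof. apply is_derive_unique. Qed.

Lemma locally_upd (U : vec -> Prop) x m :
  locally x U -> locally (x m) (fun s => U (upd x m s)).
Proof.
intros [eps H]; exists eps; intros s Hs; apply H; intro n.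
unfold upd; destruct (coord_eq_dec n m) as [->|_]; trivial.
apply ball_center.
Qed.

Lemma is_pd_ext_loc m f g x l :
  locally x (fun y => f y = g y) -> is_pd m f x l -> is_pd m g x l.
Proof. intro H; apply is_derive_ext_loc, (locally_upd _ _ m H). Qed.

Lemma pd_ext_loc m f g x :
  locally x (fun y => f y = g y) -> pd m f x = pd m g x.
Proof. intro H; apply Derive_ext_loc, (locally_upd _ _ m H). Qed.

Lemma open_imp_locally (U Q : vec -> Prop) x :
  open U -> U x -> (forall y, U y -> Q y) -> locally x Q.
Proof. intros HU Hx H; apply (filter_imp U); [exact H | exact (HU x Hx)]. Qed.

(** On an open [U], equality of functions passes to their partial derivatives, which carries the
    induction. It is needed because derivatives of elementary functions are identified on [U]
    only. *)
Lemma Ck_ext_on U k f g :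
  open U -> (forall x, U x -> f x = g x) -> Ck k U f -> Ck k U g.
Proof.
intro HU; revert f g; induction k as [|k IH]; intros f g E [Hc Hd]; split.
1,3: intros x Hx; apply (continuous_ext_loc _ f); [|exact (Hc x Hx)];
  apply (open_imp_locally U); trivial.
- exact I.
- intro m; destruct (Hd m) as [Hex Hk]; split.
  + intros x Hx; destruct (Hex x Hx) as [l Hl]; exists l.
    apply (is_pd_ext_loc m f g); [|exact Hl].
    now apply (open_imp_locally U).
  + apply (IH (pd m f)); [|exact Hk].
    intros x Hx; apply pd_ext_loc; now apply (open_imp_locally U).
Qed.

Lemma smooth_continuous U f x : smooth U f -> U x -> continuous f x.
Proof. intros H; apply (H O). Qed.

Lemma smooth_is_pd U f m x : smooth U f -> U x -> is_pd m f x (pd m f x).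
Proof. intros H Hx; apply Derive_correct; exact (proj1 (proj2 (H 1%nat) m) x Hx). Qed.

Lemma smooth_pd U f m : smooth U f -> smooth U (pd m f).
Proof. intros H k; exact (proj2 (proj2 (H (S k)) m)). Qed.

(* A class of functions containing the smooth ones and stable under partial
   derivatives, which makes all its members smooth. *)
Inductive elementary (U : vec -> Prop) : (vec -> R) -> Prop :=
| el_smooth f : smooth U f -> elementary U f
| el_const a : elementary U (fun _ => a)
| el_proj m : elementary U (fun x => x m)
| el_plus f g : elementary U f -> elementary U g ->
    elementary U (fun x => f x + g x)
| el_mult f g : elementary U f -> elementary U g ->
    elementary U (fun x => f x * g x)
| el_inv f : elementary U f -> (forall x, U x -> f x <> 0) ->
    elementary U (fun x => / f x)
| el_sin f : elementary U f -> elementary U (fun x => sin (f x))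
| el_cos f : elementary U f -> elementary U (fun x => cos (f x))
| el_sqrt f : elementary U f -> (forall x, U x -> 0 < f x) ->
    elementary U (fun x => sqrt (f x)).

Lemma is_pd_const m a x : is_pd m (fun _ => a) x 0.
Proof. exact (is_derive_const a (x m)). Qed.

Lemma is_pd_proj m n x :
  is_pd m (fun y => y n) x (if coord_eq_dec n m then 1 else 0).
Proof.
unfold is_pd, upd; destruct (coord_eq_dec n m).
- apply (is_derive_id (x m)).
- apply (is_derive_const (x n) (x m)).
Qed.

Lemma is_pd_plus m f g x l l' : is_pd m f x l -> is_pd m g x l' ->
  is_pd m (fun y => f y + g y) x (l + l').
Proof. intros H H'; exact (is_derive_plus _ _ _ _ _ H H'). Qed.

Lemma is_pd_mult m f g x l l' : is_pd m f x l -> is_pd m g x l' ->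
  is_pd m (fun y => f y * g y) x (l * g x + f x * l').
Proof.
intros H H'; generalize (is_derive_mult _ _ _ _ _ H H' Rmult_comm).
rewrite upd_id; exact (fun h => h).
Qed.

Lemma is_pd_comp m (h : R -> R) f x l l' :
  is_pd m f x l -> is_derive h (f x) l' ->
  is_pd m (fun y => h (f y)) x (l * l').
Proof.
intros H H'; apply (is_derive_comp h (fun s => f (upd x m s))); [|exact H].
now rewrite upd_id.
Qed.

Lemma continuous_proj m (x : vec) : continuous (fun y : vec => y m) x.
Proof. intros Q [eps H]; exists eps; intros y Hy; apply H, Hy. Qed.

Lemma elementary_continuous U f x : elementary U f -> U x -> continuous f x.
Proof.
intros H Hx; induction H as [f H|a|m|f g _ IHf _ IHg|f g _ IHf _ IHg|f _ IH Hn
  |f _ IH|f _ IH|f _ IH Hp].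
- exact (smooth_continuous U f x H Hx).
- apply continuous_const.
- apply continuous_proj.
- now apply @continuous_plus.
- now apply @continuous_mult.
- apply continuous_comp; [exact IH|]; apply continuous_Rinv, Hn, Hx.
- apply continuous_comp; [exact IH|]; apply continuous_sin.
- apply continuous_comp; [exact IH|]; apply continuous_cos.
- apply continuous_comp; [exact IH|]; apply continuous_sqrt.
Qed.

Lemma elementary_pd U f m : elementary U f ->
  exists g, elementary U g /\ forall x, U x -> is_pd m f x (g x).
Proof.
intro H; induction H as [f H|a|n|f g Hf [f' [Hf' Df]] Hg [g' [Hg' Dg]]
  |f g Hf [f' [Hf' Df]] Hg [g' [Hg' Dg]]|f Hf [f' [Hf' Df]] Hn
  |f Hf [f' [Hf' Df]]|f Hf [f' [Hf' Df]]|f Hf [f' [Hf' Df]] Hp].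
- exists (pd m f); split; [apply el_smooth, smooth_pd, H|].
  intros x Hx; now apply (smooth_is_pd U).
- exists (fun _ => 0); split; [apply el_const|]; intros; apply is_pd_const.
- exists (fun _ => if coord_eq_dec n m then 1 else 0).
  split; [apply el_const|]; intros; apply is_pd_proj.
- exists (fun x => f' x + g' x); split; [now apply el_plus|].
  intros x Hx; apply is_pd_plus; auto.
- exists (fun x => f' x * g x + f x * g' x).
  split; [apply el_plus; now apply el_mult|].
  intros x Hx; apply is_pd_mult; auto.
- exists (fun x => f' x * (- 1 * (/ f x * / f x))); split.
  + repeat (apply el_mult || apply el_const); trivial; now apply el_inv.
  + intros x Hx; apply (is_pd_comp m Rinv); auto.
    assert (Hfx := Hn x Hx); auto_derive; trivial; now field.
- exists (fun x => f' x * cos (f x)); split.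
  + apply el_mult; trivial; now apply el_cos.
  + intros x Hx; apply (is_pd_comp m sin); auto.
    auto_derive; trivial; ring.
- exists (fun x => f' x * (- 1 * sin (f x))); split.
  + apply el_mult; trivial; apply el_mult; [apply el_const|now apply el_sin].
  + intros x Hx; apply (is_pd_comp m cos); auto.
    auto_derive; trivial; ring.
- exists (fun x => f' x * (/ 2 * / sqrt (f x))); split.
  + apply el_mult; trivial; apply el_mult; [apply el_const|].
    apply el_inv; [now apply el_sqrt|].
    intros x Hx; apply Rgt_not_eq, sqrt_lt_R0, Hp, Hx.
  + intros x Hx; apply (is_pd_comp m sqrt); auto.
    assert (Hfx := Hp x Hx); assert (Hs := sqrt_lt_R0 _ Hfx).
    auto_derive; trivial; field; lra.
Qed.

(** Induction on the order of differentiability: [elementary_pd] supplies an elementary function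
    that equals the partial derivative on [U]. *)
Lemma elementary_smooth U f : open U -> elementary U f -> smooth U f.
Proof.
intros HU H k; revert f H; induction k as [|k IH]; intros f H; split.
1,3: intros x Hx; now apply (elementary_continuous U).
- exact I.
- intro m; destruct (elementary_pd U f m H) as [g [Hg D]]; split.
  + intros x Hx; exists (g x); exact (D x Hx).
  + apply (Ck_ext_on U k g); auto.
    intros x Hx; symmetry; apply is_pd_unique; auto.
Qed.

Lemma upd_comm (x : vec) m n s t : m <> n ->
  upd (upd x m s) n t = upd (upd x n t) m s.
Proof.
intro H; apply functional_extensionality; intro k; unfold upd.
destruct (coord_eq_dec k n), (coord_eq_dec k m); congruence.
Qed.

Lemma continuous_upd2 (x : vec) m n (z : R * R) :
  continuous (fun z : R * R => upd (upd x m (fst z)) n (snd z)) z.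
Proof.
intros Q [eps H]; exists eps; intros w [Hw1 Hw2]; apply H; intro k; unfold upd.
destruct (coord_eq_dec k n); [exact Hw2|].
destruct (coord_eq_dec k m); [exact Hw1|apply ball_center].
Qed.

(** Joint differentiability in the two moving coordinates follows from the continuity of one partial
    derivative. Two coordinates are enough, since [trans] leaves [t] and [r] alone. *)
Lemma is_derive_comp_upd2 U (v : vec -> R) x m n f g s f' g' :
  open U -> smooth U v -> m <> n ->
  U (upd (upd x m (f s)) n (g s)) ->
  is_derive f s f' -> is_derive g s g' ->
  is_derive (fun s => v (upd (upd x m (f s)) n (g s))) s
    (pd m v (upd (upd x m (f s)) n (g s)) * f' +
     pd n v (upd (upd x m (f s)) n (g s)) * g').
Proof.
intros HU Hv Hmn Hx Hf Hg.
assert (Dm : forall a b, U (upd (upd x m a) n b) ->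
  is_derive (fun z => v (upd (upd x m z) n b)) a
    (pd m v (upd (upd x m a) n b))).
{ intros a b H; generalize (smooth_is_pd U v m _ Hv H); unfold is_pd.
  replace (upd (upd x m a) n b m) with a
    by now rewrite upd_comm, upd_at.
  apply is_derive_ext; intro z.
  now rewrite (upd_comm x m n a b Hmn), upd_upd, <- upd_comm. }
assert (Dn : forall a b, U (upd (upd x m a) n b) ->
  is_derive (fun z => v (upd (upd x m a) n z)) b
    (pd n v (upd (upd x m a) n b))).
{ intros a b H; generalize (smooth_is_pd U v n _ Hv H); unfold is_pd.
  rewrite upd_at; apply is_derive_ext; intro z; now rewrite upd_upd. }
apply is_derive_Reals.
apply (derivable_pt_lim_comp_2d (fun a b => v (upd (upd x m a) n b)) f g);
  try now apply is_derive_Reals.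
apply filterdiff_differentiable_pt_lim.
apply (is_derive_filterdiff (fun a b => v (upd (upd x m a) n b)) (f s) (g s)
  (fun a b => pd m v (upd (upd x m a) n b))).
- apply (filter_imp (fun z => U (upd (upd x m (fst z)) n (snd z)))).
  + intros z Hz; now apply Dm.
  + exact (continuous_upd2 x m n (f s, g s) U (HU _ Hx)).
- now apply Dn.
- apply (continuous_comp (fun z : R * R => upd (upd x m (fst z)) n (snd z))).
  + apply continuous_upd2.
  + apply (smooth_continuous U); [now apply smooth_pd|exact Hx].
Qed.

Lemma pd_mult m f g x l l' : is_pd m f x l -> is_pd m g x l' ->
  pd m (fun y => f y * g y) x = l * g x + f x * l'.
Proof. intros; now apply is_pd_unique, is_pd_mult. Qed.

Lemma elementary_opp U f : elementary U f -> elementary U (fun x => - f x).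
Proof.
intro H; replace (fun x => - f x) with (fun x => -1 * f x).
- apply el_mult; [apply el_const|exact H].
- apply functional_extensionality; intro; ring.
Qed.

Lemma elementary_minus U f g : elementary U f -> elementary U g ->
  elementary U (fun x => f x - g x).
Proof. intros; apply el_plus; [|apply elementary_opp]; trivial. Qed.

Lemma elementary_pow U f k : elementary U f -> elementary U (fun x => f x ^ k).
Proof.
intro H; induction k as [|k IH]; simpl; [apply el_const|now apply el_mult].
Qed.

Ltac elementary_using tac :=
  repeat (tac || apply elementary_minus || apply elementary_opp ||
    apply elementary_pow || apply el_proj || apply el_const ||
    apply el_plus || apply el_mult || apply el_sin || apply el_cos).

Ltac elementary := elementary_using fail.

Lemma continuous_locally_neq (f : vec -> R) x a :
  continuous f x -> f x <> a -> locally x (fun y => f y <> a).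
Proof. intros Hf Hx; exact (Hf _ (open_neq a _ Hx)). Qed.

Lemma eq0_dense (f : vec -> R) x : continuous f x ->
  (forall Q, locally x Q -> exists y, Q y /\ f y = 0) -> f x = 0.
Proof.
intros Hf H; destruct (Req_dec (f x) 0) as [|Hn]; trivial.
destruct (H _ (continuous_locally_neq f x 0 Hf Hn)) as [y [Hy Hy']].
contradiction.
Qed.

(** * The smooth extension of the operator in each chart *)

Definition sumR (f : coord -> R) : R := f c0 + f c1 + f c2 + f c3.

Definition delta (m n : coord) : R := if coord_eq_dec n m then 1 else 0.

(** Evaluates each [Derive]: [auto_derive] computes the derivative, and the closing [reflexivity]
    assigns it to the existential variable. *)
Ltac derive_explicit :=
  repeat match goal with
  | |- context [Derive ?f ?s] =>
    let l := fresh in evar (l : R); let l' := eval unfold l in l in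
    rewrite (is_derive_unique f s l')
      by (unfold l; auto_derive; [try lra; trivial|reflexivity]); clear l
  end.

Lemma pdC_pdC m n u x : pdC m (pdC n u) x =
  (pd m (pd n (fun y => Re (u y))) x, pd m (pd n (fun y => Im (u y))) x).
Proof. reflexivity. Qed.

Section Kerr_symbol.
Variables (rs c : R) (kappa : point -> C).
Hypothesis Hc : 0 < c.
Let a := spin rs.

Definition chart_sin2 (X : chart) (x : vec) : R :=
  match X with BL => (sin (x c2))^2 | _ => (x c2)^2 + (x c3)^2 end.

Definition chart_phi (X : chart) (x p : vec) : R :=
  match X with BL => p c3 | _ => x c2 * p c3 - x c3 * p c2 end.

(** The inverse metric of the unit sphere. In the polar charts it is the identity minus the outer
    product of [(omega_x, omega_y)] with itself. *)
Definition chart_sphere (X : chart) (x p p' : vec) : R :=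
  match X with
  | BL => p c2 * p' c2 + p c3 * p' c3 * / (sin (x c2))^2
  | _ => p c2 * p' c2 + p c3 * p' c3
         - (x c2 * p c2 + x c3 * p c3) * (x c2 * p' c2 + x c3 * p' c3)
  end.

Definition chart_W (X : chart) (x p : vec) : R :=
  ((x c1)^2 + a^2) * p c0 + a * c * chart_phi X x p.

(** The polarization of [E] with its square expanded: the term [p_phi^2 / sin(theta)^2] joins
    [p_theta^2] in the inverse sphere metric, and the remaining terms are smooth at the axis. *)
Definition chart_E (X : chart) (x p p' : vec) : R :=
  a^2 * chart_sin2 X x * / c^2 * p c0 * p' c0
  + a * / c * (p c0 * chart_phi X x p' + p' c0 * chart_phi X x p)
  + chart_sphere X x p p'.

(* The smooth extension of Delta g^{mn} p_m p'_n. *)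
Definition chart_form (X : chart) (x p p' : vec) : R :=
  / Sigma rs (par X x) *
  (- / c^2 * chart_W X x p * chart_W X x p'
   + Delta rs (par X x) *
     (chart_E X x p p' + Delta rs (par X x) * p c1 * p' c1)).

Definition chart_coef2 (X : chart) (m n : coord) (x : vec) : R :=
  chart_form X x (delta m) (delta n).

(** In [BL] these are [Delta / vol] times the derivatives of [vol * ginv]. In the polar charts they
    come from applying the operator to the coordinates: [omega_x] and [omega_y] are eigenfunctions
    of the sphere Laplacian for [-2], which gives [- 2 Delta], and the part [- a^2 p_phi^2] of
    [- W^2 / c^2] acts on them as [a^2]. *)
Definition chart_coef1 (X : chart) (m : coord) (x : vec) : R :=
  / Sigma rs (par X x) *
  match X, m with
  | _, c0 => 0
  | _, c1 => Delta rs (par X x) * (2 * x c1 - rs)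
  | BL, c2 => Delta rs (par X x) * (cos (x c2) * / sin (x c2))
  | BL, c3 => 0
  | _, m => (a^2 - 2 * Delta rs (par X x)) * x m
  end.

Definition chart_op (X : chart) : diffop :=
  Diffop (fun m n x => RtoC (chart_coef2 X m n x))
    (fun m x => RtoC (chart_coef1 X m x)) (fun x => kappa (par X x)).

Definition chart_opR (X : chart) (f : vec -> R) (x : vec) : R :=
  sumR (fun m => sumR (fun n => chart_coef2 X m n x * pd m (pd n f) x))
  + sumR (fun m => chart_coef1 X m x * pd m f x).

Lemma chart_op_apply X u x :
  apply_diffop (chart_op X) u x =
  (RtoC (chart_opR X (fun y => Re (u y)) x)
   + Ci * RtoC (chart_opR X (fun y => Im (u y)) x)
   + kappa (par X x) * u x)%C.
Proof.
unfold apply_diffop; f_equal.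
unfold chart_opR, sumC, sumR, chart_op; cbn [coef2 coef1].
rewrite !pdC_pdC; apply injective_projections; cbn; ring.
Qed.

Lemma chart_form_sum X x p p' :
  sumR (fun m => sumR (fun n => chart_coef2 X m n x * p m * p' n)) =
  chart_form X x p p'.
Proof.
unfold sumR, chart_coef2, chart_form, chart_W, chart_E, delta.
destruct X; cbn; ring.
Qed.

Lemma Sigma_continuous X (x : vec) : continuous (fun y => Sigma rs (par X y)) x.
Proof.
apply @continuous_plus.
- apply @continuous_mult; [destruct X; apply continuous_proj|].
  apply @continuous_mult; [destruct X; apply continuous_proj|apply continuous_const].
- apply @continuous_mult; [apply continuous_const|].
  apply (continuous_comp (fun y => par X y Az) (fun s : R => s^2)).
  + destruct X; cbn.
    * apply continuous_comp; [apply continuous_proj|apply continuous_cos].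
    * apply continuous_comp; [|apply continuous_sqrt].
      apply (elementary_continuous (fun _ => True)); [elementary|exact I].
    * apply @continuous_opp.
      apply continuous_comp; [|apply continuous_sqrt].
      apply (elementary_continuous (fun _ => True)); [elementary|exact I].
  + apply @continuous_mult; [apply continuous_id|].
    apply @continuous_mult; [apply continuous_id|apply continuous_const].
Qed.

Definition inner (X : chart) (x : vec) : Prop :=
  match X with BL => 0 < x c2 < PI | _ => (x c2)^2 + (x c3)^2 < 1 end.

Lemma dom_iff X x : dom rs X x <-> Sigma rs (par X x) <> 0 /\ inner X x.
Proof.
split; [intros [[_ H] H']; split; trivial|].
intros [H H']; repeat split; trivial.
unfold sin2, cos2; destruct X; cbn in *.
- transitivity ((sin (x c2))^2 * (Rsqr (sin (x c3)) + Rsqr (cos (x c3)))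
    + (cos (x c2))^2); [unfold Rsqr; ring|].
  rewrite sin2_cos2; generalize (sin2_cos2 (x c2)); unfold Rsqr; lra.
- rewrite !Rmult_1_r, sqrt_sqrt by lra; ring.
- rewrite !Rmult_1_r, Rmult_opp_opp, sqrt_sqrt by lra; ring.
Qed.

Lemma open_dom X : open (dom rs X).
Proof.
apply (open_ext (fun x => Sigma rs (par X x) <> 0 /\ inner X x)).
{ intro x; symmetry; apply dom_iff. }
apply open_and.
- apply (open_comp (fun y => Sigma rs (par X y)) (fun s => s <> 0)).
  + intros x _; apply Sigma_continuous.
  + apply open_neq.
- destruct X; cbn.
  + apply open_and.
    * apply (open_comp (fun y : vec => y c2) (fun s => 0 < s)); [|apply open_gt].
      intros x _; apply continuous_proj.
    * apply (open_comp (fun y : vec => y c2) (fun s => s < PI)); [|apply open_lt].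
      intros x _; apply continuous_proj.
  + apply (open_comp (fun y : vec => (y c2)^2 + (y c3)^2) (fun s => s < 1));
      [|apply open_lt].
    intros x _; apply (elementary_continuous (fun _ => True)); [elementary|exact I].
  + apply (open_comp (fun y : vec => (y c2)^2 + (y c3)^2) (fun s => s < 1));
      [|apply open_lt].
    intros x _; apply (elementary_continuous (fun _ => True)); [elementary|exact I].
Qed.

Lemma elementary_par X i : elementary (dom rs X) (fun x => par X x i).
Proof.
assert (H : forall X, X <> BL -> elementary (dom rs X)
  (fun x => sqrt (1 - (x c2)^2 - (x c3)^2))).
{ intros Y HY; apply el_sqrt; [elementary|].
  intros x Hx; apply dom_iff in Hx; destruct Y; [easy|destruct Hx; cbn in *; lra..]. }
destruct X, i; cbn; elementary; apply H; discriminate.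
Qed.

Lemma elementary_inv_Sigma X :
  elementary (dom rs X) (fun x => / Sigma rs (par X x)).
Proof.
apply el_inv; [|intros x Hx; now apply dom_iff in Hx].
unfold Sigma, cos2; elementary; apply elementary_par.
Qed.

Lemma elementary_Delta X : elementary (dom rs X) (fun x => Delta rs (par X x)).
Proof. unfold Delta; elementary; apply elementary_par. Qed.

Lemma dom_BL_sin x : dom rs BL x -> 0 < sin (x c2).
Proof. intros [_ [H H']]; now apply sin_gt_0. Qed.

Lemma elementary_inv_sin : elementary (dom rs BL) (fun x => / sin (x c2)).
Proof.
apply el_inv; [elementary|]; intros x Hx; apply Rgt_not_eq, dom_BL_sin, Hx.
Qed.

Lemma elementary_W X p : elementary (dom rs X) (fun x => chart_W X x p).
Proof. unfold chart_W, chart_phi; destruct X; elementary. Qed.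

Lemma elementary_E X p p' : elementary (dom rs X) (fun x => chart_E X x p p').
Proof.
unfold chart_E, chart_sin2, chart_phi, chart_sphere; destruct X; elementary.
apply el_inv; [elementary|]; intros x Hx.
apply pow_nonzero, Rgt_not_eq, dom_BL_sin, Hx.
Qed.

Lemma elementary_coef2 X m n : elementary (dom rs X) (chart_coef2 X m n).
Proof.
unfold chart_coef2, chart_form.
apply el_mult; [apply elementary_inv_Sigma|].
elementary_using
  ltac:(apply elementary_W || apply elementary_E || apply elementary_Delta).
Qed.

Lemma elementary_coef1 X m : elementary (dom rs X) (chart_coef1 X m).
Proof.
unfold chart_coef1; apply el_mult; [apply elementary_inv_Sigma|].
destruct X, m; elementary_using
  ltac:(apply elementary_Delta || apply elementary_inv_sin).
Qed.

Lemma chart_op_smooth X : smoothM rs kappa -> smooth_coefs (dom rs X) (chart_op X).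
Proof.
intro Hk; assert (H0 : smooth (dom rs X) (fun _ => 0))
  by (apply elementary_smooth; [apply open_dom|apply el_const]).
repeat split; cbn; trivial; try apply Hk; apply elementary_smooth;
  try apply open_dom; apply elementary_coef2 || apply elementary_coef1.
Qed.

Lemma elementary_opR X f :
  smooth (dom rs X) f -> elementary (dom rs X) (chart_opR X f).
Proof.
intro Hf; unfold chart_opR, sumR.
elementary_using ltac:(apply elementary_coef2 || apply elementary_coef1
  || exact (el_smooth _ _ (smooth_pd _ _ _ Hf))
  || exact (el_smooth _ _ (smooth_pd _ _ _ (smooth_pd _ _ _ Hf)))).
Qed.

(** * Ambient description of the symbol *)

(** For [e = mom l] this is the momentum [p] prescribed by [has_coords]. *)
Definition pull (X : chart) (x : vec) (e : amb -> R) : vec := fun m =>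
  e At * pd m (fun y => par X y At) x +
  e Ar * pd m (fun y => par X y Ar) x +
  e Ax * pd m (fun y => par X y Ax) x +
  e Ay * pd m (fun y => par X y Ay) x +
  e Az * pd m (fun y => par X y Az) x.

Definition amb_phi (q : point) (e : amb -> R) : R := q Ax * e Ay - q Ay * e Ax.

Definition amb_W (q : point) (e : amb -> R) : R :=
  ((q Ar)^2 + a^2) * e At + a * c * amb_phi q e.

Definition dot3 (e e' : amb -> R) : R :=
  e Ax * e' Ax + e Ay * e' Ay + e Az * e' Az.

(** The product [dot3 q e * dot3 q e'] removes the components normal to the sphere, so that at
    points of [M] the value depends only on the restrictions of [e] and [e'] to tangent vectors. *)
Definition amb_form (q : point) (e e' : amb -> R) : R :=
  / Sigma rs q *
  (- / c^2 * amb_W q e * amb_W q e'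
   + Delta rs q *
     (a^2 * sin2 q * / c^2 * e At * e' At
      + a * / c * (e At * amb_phi q e' + e' At * amb_phi q e)
      + dot3 e e' - dot3 q e * dot3 q e'
      + Delta rs q * e Ar * e' Ar)).

Lemma pull_BL x e : pull BL x e = fun m =>
  match m with
  | c0 => e At
  | c1 => e Ar
  | c2 => cos (x c2) * cos (x c3) * e Ax + cos (x c2) * sin (x c3) * e Ay
          - sin (x c2) * e Az
  | c3 => sin (x c2) * (cos (x c3) * e Ay - sin (x c3) * e Ax)
  end.
Proof.
apply functional_extensionality; intro m; unfold pull, pd, upd.
destruct m; cbn; derive_explicit; ring.
Qed.

(** On either hemisphere [omega_z d omega_z = - (x dx + y dy)], so one formula covers both signs of
    the root. *)
Lemma pull_pole X x e : X <> BL -> dom rs X x -> pull X x e = fun m =>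
  match m with
  | c0 => e At
  | c1 => e Ar
  | c2 => e Ax - x c2 / par X x Az * e Az
  | c3 => e Ay - x c3 / par X x Az * e Az
  end.
Proof.
intros HX Hx; apply dom_iff in Hx; destruct Hx as [_ Hx].
apply functional_extensionality; intro m; unfold pull, pd, upd.
destruct X; [easy| |]; cbn in Hx;
assert (Hs : 0 < sqrt (1 - (x c2)^2 - (x c3)^2))
  by (apply sqrt_lt_R0; cbn; lra);
destruct m; cbn; derive_explicit; cbn in Hs; try ring; unfold Rminus in *; field; lra.
Qed.

Lemma pull_phi X x e : dom rs X x ->
  chart_phi X x (pull X x e) = amb_phi (par X x) e.
Proof.
intro Hx; destruct X; [rewrite pull_BL|rewrite pull_pole by easy..];
  unfold amb_phi; cbn; unfold Rdiv; ring.
Qed.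

Lemma pull_W X x e : dom rs X x ->
  chart_W X x (pull X x e) = amb_W (par X x) e.
Proof.
intro Hx; unfold chart_W, amb_W; rewrite pull_phi by trivial.
f_equal; f_equal; [destruct X; reflexivity|].
destruct X; [rewrite pull_BL|rewrite pull_pole by easy..]; reflexivity.
Qed.

Lemma chart_sin2_par X x : chart_sin2 X x = sin2 (par X x).
Proof.
unfold sin2; destruct X; try reflexivity; cbn.
generalize (sin2_cos2 (x c3)); unfold Rsqr; intro H.
transitivity ((sin (x c2))^2 * (sin (x c3) * sin (x c3) + cos (x c3) * cos (x c3)));
  [rewrite H|]; ring.
Qed.

Lemma dom_pole_z X x : X <> BL -> dom rs X x ->
  par X x Az <> 0 /\ par X x Az * par X x Az = 1 - x c2 * x c2 - x c3 * x c3.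
Proof.
intros HX Hx; apply dom_iff in Hx; destruct Hx as [_ Hx].
destruct X; [easy| |]; cbn in Hx |- *;
  assert (Hs : 0 < sqrt (1 - x c2 * (x c2 * 1) - x c3 * (x c3 * 1)))
  by (apply sqrt_lt_R0; lra);
  split; try lra; [|rewrite Rmult_opp_opp]; rewrite sqrt_sqrt by lra; ring.
Qed.

Lemma pull_sphere X x e e' : dom rs X x ->
  chart_sphere X x (pull X x e) (pull X x e') =
  dot3 e e' - dot3 (par X x) e * dot3 (par X x) e'.
Proof.
intro Hx; unfold chart_sphere, dot3.
destruct X; [rewrite !pull_BL|rewrite !pull_pole by easy..].
- assert (Hs := dom_BL_sin x Hx); cbn.
  generalize (sin2_cos2 (x c2)) (sin2_cos2 (x c3)); unfold Rsqr; intros H2 H3.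
  set (s2 := sin (x c2)) in *; set (k2 := cos (x c2)) in *.
  set (s3 := sin (x c3)) in *; set (k3 := cos (x c3)) in *.
  assert (E2 : k2 * k2 = 1 - s2 * s2) by lra.
  assert (E3 : k3 * k3 = 1 - s3 * s3) by lra.
  field [E2 E3]; lra.
- destruct (dom_pole_z North x) as [Hz E]; try easy.
  change (par North x Ax) with (x c2); change (par North x Ay) with (x c3).
  cbv beta iota; field [E]; trivial.
- destruct (dom_pole_z South x) as [Hz E]; try easy.
  change (par South x Ax) with (x c2); change (par South x Ay) with (x c3).
  cbv beta iota; field [E]; trivial.
Qed.

Lemma pull_form X x e e' : dom rs X x ->
  chart_form X x (pull X x e) (pull X x e') = amb_form (par X x) e e'.
Proof.
intro Hx; unfold chart_form, amb_form, chart_E.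
rewrite !pull_W, !pull_phi, pull_sphere, chart_sin2_par by trivial.
assert (H : forall e, pull X x e c0 = e At /\ pull X x e c1 = e Ar)
  by (intro e''; destruct X; [rewrite pull_BL|rewrite pull_pole by easy..];
      split; reflexivity).
rewrite !(proj1 (H _)), !(proj2 (H _)); ring.
Qed.

End Kerr_symbol.

(** * The chart operator and the wave operator in Boyer-Lindquist coordinates *)

Section Kerr_operator.
Variables (rs c : R).
Hypothesis Hc : 0 < c.

Definition boxR (f : vec -> R) (x : vec) : R :=
  / vol rs x * sumR (fun m => sumR (fun n =>
     pd m (fun y => vol rs y * ginv rs c m n y * pd n f y) x)).

Lemma pdC_real_mult m n (w : vec -> R) u x :
  pdC m (fun y => RtoC (w y) * pdC n u y)%C x =
  (pd m (fun y => w y * pd n (fun z => Re (u z)) y) x,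
   pd m (fun y => w y * pd n (fun z => Im (u z)) y) x).
Proof. apply injective_projections; apply Derive_ext; intro s; cbn; ring. Qed.

Lemma box_eq u x : box rs c u x =
  (RtoC (boxR (fun y => Re (u y)) x)
   + Ci * RtoC (boxR (fun y => Im (u y)) x))%C.
Proof.
unfold box, boxR, sumC, sumR; rewrite !pdC_real_mult.
apply injective_projections; cbn; ring.
Qed.

Lemma ginv_coef m n x : dom rs BL x -> Delta rs (par BL x) <> 0 ->
  Delta rs (par BL x) * ginv rs c m n x = chart_coef2 rs c BL m n x.
Proof.
intros Hx HD; assert (Hs := dom_BL_sin rs x Hx).
destruct Hx as [[_ HS] _].
(* As rewrite rules for [field], [E1] and [E2] express [rs * r] and [a^2 sin(theta)^2] through
   [Delta] and [Sigma], which are then treated as atoms. *)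
assert (E1 : rs * x c1 = x c1 * x c1 + spin rs * spin rs - Delta rs (par BL x))
  by (unfold Delta; cbn; ring).
assert (E2 : spin rs * spin rs * sin (x c2) * sin (x c2)
  = x c1 * x c1 + spin rs * spin rs - Sigma rs (par BL x)).
{ unfold Sigma, cos2; cbn; generalize (sin2_cos2 (x c2)); unfold Rsqr; intro E.
  replace (cos (x c2) * (cos (x c2) * 1)) with (1 - sin (x c2) * sin (x c2)) by lra.
  ring. }
unfold chart_coef2, chart_form, chart_W, chart_E, chart_sphere, chart_sin2,
  chart_phi, delta.
destruct m, n; cbn; change (par BL x Ar) with (x c1);
  field [E1 E2]; repeat split; lra || trivial.
Qed.

Lemma pd_mult_const m h k x : (forall s, h (upd x m s) = h x) ->
  pd m (fun y => h y * k y) x = h x * pd m k x.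
Proof.
intro H; transitivity (Derive (fun s => h x * k (upd x m s)) (x m)).
- apply Derive_ext; intro s; now rewrite H.
- apply Derive_scal.
Qed.

Lemma pd_zero_mult m h k x : (forall y, h y = 0) ->
  pd m (fun y => h y * k y) x = 0.
Proof.
intro H; rewrite pd_mult_const by (intro; now rewrite !H); rewrite H; ring.
Qed.

Lemma boxR_eq f x : smooth (dom rs BL) f -> dom rs BL x ->
  Delta rs (par BL x) <> 0 ->
  Delta rs (par BL x) * boxR f x = chart_opR rs c BL f x.
Proof.
intros Hf Hx HD; assert (Hs := dom_BL_sin rs x Hx).
assert (HS := proj1 (proj1 (dom_iff rs BL x) Hx)).
assert (Hg : forall m n, Delta rs (par BL x) * / vol rs x
  * (vol rs x * ginv rs c m n x) = chart_coef2 rs c BL m n x).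
{ intros m n; rewrite <- ginv_coef by trivial; unfold vol; field; lra || auto. }
assert (Dn : forall m n, is_pd m (pd n f) x (pd m (pd n f) x))
  by (intros; apply (smooth_is_pd (dom rs BL)); [now apply smooth_pd|trivial]).
(* The entries of [vol * ginv] do not depend on [t] or [phi]. Differentiation in [r] or [theta]
   meets only the diagonal entries, [Delta sin(theta)] and [sin(theta)], because the others in those
   rows vanish. *)
assert (T : forall m n,
  pd m (fun y => vol rs y * ginv rs c m n y * pd n f y) x =
  match m, n with
  | c1, c1 => (2 * x c1 - rs) * sin (x c2)
  | c2, c2 => cos (x c2)
  | _, _ => 0
  end * pd n f x + vol rs x * ginv rs c m n x * pd m (pd n f) x).
{ assert (Dloc : forall m h l, (forall y, dom rs BL y ->
      h y = vol rs y * ginv rs c m m y) -> is_pd m h x l ->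
    pd m (fun y => vol rs y * ginv rs c m m y * pd m f y) x
    = l * pd m f x + vol rs x * ginv rs c m m x * pd m (pd m f) x).
  { intros m h l E Dh; rewrite <- (E x Hx); apply is_pd_unique.
    apply (is_pd_ext_loc _ (fun y => h y * pd m f y)); [|now apply is_pd_mult].
    apply (open_imp_locally (dom rs BL)); [apply open_dom|exact Hx|].
    intros y Hy; now rewrite E. }
  intros m n; destruct m, n;
    try (rewrite pd_mult_const by (intro; reflexivity); ring);
    try (rewrite pd_zero_mult by (intro; cbn; ring); cbn; ring).
  - apply (Dloc c1 (fun y => Delta rs (par BL y) * sin (y c2))).
    + intros y Hy; apply dom_iff in Hy; unfold vol; cbn; field; apply Hy.
    + unfold is_pd, Delta, upd; cbn; auto_derive; trivial; ring.
  - apply (Dloc c2 (fun y => sin (y c2))).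
    + intros y Hy; apply dom_iff in Hy; unfold vol; cbn; field; apply Hy.
    + unfold is_pd, upd; cbn; auto_derive; trivial; ring. }
unfold boxR, chart_opR, sumR; rewrite !T, <- !Hg.
unfold chart_coef1; cbn -[vol ginv par]; unfold vol.
field; lra || auto.
Qed.
End Kerr_operator.

(** * Change of coordinates between BL and the polar charts *)

Lemma sumR_ext f g : (forall i, f i = g i) -> sumR f = sumR g.
Proof. intro H; unfold sumR; now rewrite !H. Qed.

(** The chain rule for a second-order operator as pure algebra: [J] and [H] hold the first and
    second derivatives of the new coordinates, [g] and [G] the gradient and Hessian of the function.
    The new first-order coefficients are the operator applied to the new coordinates. *)
Lemma second_order_chain A B (J G : coord -> coord -> R) g H :
  sumR (fun m => sumR (fun n => A m n * sumR (fun k =>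
    sumR (fun l => G l k * J l m) * J k n + g k * H k m n)))
  + sumR (fun m => B m * sumR (fun k => g k * J k m))
  = sumR (fun l => sumR (fun k =>
      sumR (fun m => sumR (fun n => A m n * J l m * J k n)) * G l k))
    + sumR (fun k => (sumR (fun m => sumR (fun n => A m n * H k m n))
        + sumR (fun m => B m * J k m)) * g k).
Proof.
unfold sumR.
ring.
Qed.

Lemma is_pd_sumR m (F : coord -> vec -> R) x l :
  (forall k, is_pd m (F k) x (l k)) ->
  is_pd m (fun y => sumR (fun k => F k y)) x (sumR l).
Proof. intro H; unfold sumR; repeat apply is_pd_plus; apply H. Qed.

(* Coordinates of the polar charts in terms of those of BL. *)
Definition trans (x : vec) : vec := fun m =>
  match m with
  | c2 => sin (x c2) * cos (x c3)
  | c3 => sin (x c2) * sin (x c3)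
  | _ => x m
  end.

Definition hemisphere (X : chart) (x : vec) : Prop :=
  match X with BL => False | North => 0 < cos (x c2) | South => cos (x c2) < 0 end.

Lemma par_trans X x : hemisphere X x -> par X (trans x) = par BL x.
Proof.
intro H; apply functional_extensionality; intro i.
assert (E : sqrt (1 - (sin (x c2) * cos (x c3))^2 - (sin (x c2) * sin (x c3))^2)
  = Rabs (cos (x c2))).
{ rewrite <- sqrt_Rsqr_abs; f_equal.
  generalize (sin2_cos2 (x c2)) (sin2_cos2 (x c3)); unfold Rsqr; intros E2 E3.
  replace (cos (x c2) * cos (x c2)) with (1 - sin (x c2) * sin (x c2)) by lra.
  transitivity (1 - sin (x c2) * sin (x c2)
    * (sin (x c3) * sin (x c3) + cos (x c3) * cos (x c3))); [|rewrite E3]; ring. }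
destruct X, i; try easy; cbn in *; rewrite E;
  [apply Rabs_pos_eq|rewrite Rabs_left by trivial]; lra.
Qed.

Lemma dom_trans rs X x : dom rs BL x -> hemisphere X x -> dom rs X (trans x).
Proof.
intros Hx H; apply dom_iff; rewrite par_trans by trivial.
apply dom_iff in Hx; split; [apply Hx|].
assert (E : (trans x c2)^2 + (trans x c3)^2 < 1).
{ cbn; generalize (sin2_cos2 (x c2)) (sin2_cos2 (x c3)); unfold Rsqr; intros E2 E3.
  assert (0 < cos (x c2) * cos (x c2))
    by (destruct X; cbn in H; [easy|nra|nra]).
  apply Rle_lt_trans with (sin (x c2) * sin (x c2)
    * (sin (x c3) * sin (x c3) + cos (x c3) * cos (x c3))).
  - apply Req_le; ring.
  - rewrite E3; lra. }
destruct X; easy.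
Qed.

Lemma pd_trans n k x : pd n (fun y => trans y k) x =
  match k, n with
  | c0, c0 | c1, c1 => 1
  | c2, c2 => cos (x c2) * cos (x c3)
  | c3, c2 => cos (x c2) * sin (x c3)
  | c2, c3 => - (sin (x c2) * sin (x c3))
  | c3, c3 => sin (x c2) * cos (x c3)
  | _, _ => 0
  end.
Proof. unfold pd, upd; destruct n, k; cbn; derive_explicit; ring. Qed.

Lemma pd_comp_trans rs X w n x : smooth (dom rs X) w ->
  dom rs BL x -> hemisphere X x ->
  is_pd n (fun y => w (trans y)) x
    (sumR (fun k => pd k w (trans x) * pd n (fun y => trans y k) x)).
Proof.
intros Hw Hx H; assert (Hd := dom_trans rs X x Hx H).
unfold sumR; rewrite !pd_trans.
assert (E : forall y, trans y =
  upd (upd (trans y) c2 (sin (y c2) * cos (y c3))) c3 (sin (y c2) * sin (y c3)))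
  by (intro y; apply functional_extensionality; intros []; reflexivity).
assert (E' : forall m s, m = c2 \/ m = c3 -> trans (upd x m s) =
  upd (upd (trans x) c2 (sin (upd x m s c2) * cos (upd x m s c3)))
    c3 (sin (upd x m s c2) * sin (upd x m s c3)))
  by (intros m s [-> | ->]; apply functional_extensionality; intros []; reflexivity).
assert (C2 : forall m f' g', m = c2 \/ m = c3 ->
  is_pd m (fun y => sin (y c2) * cos (y c3)) x f' ->
  is_pd m (fun y => sin (y c2) * sin (y c3)) x g' ->
  is_pd m (fun y => w (trans y)) x
    (pd c2 w (trans x) * f' + pd c3 w (trans x) * g')).
{ intros m f' g' Hm Hf Hg; unfold is_pd.
  apply (is_derive_ext (fun s =>
    w (upd (upd (trans x) c2 (sin (upd x m s c2) * cos (upd x m s c3)))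
      c3 (sin (upd x m s c2) * sin (upd x m s c3))))).
  { intro s; now rewrite <- E'. }
  assert (Ex := E' m (x m) Hm).
  assert (Hd' := Hd); rewrite <- (upd_id x m), Ex in Hd'.
  generalize (is_derive_comp_upd2 (dom rs X) w (trans x) c2 c3
    (fun s => sin (upd x m s c2) * cos (upd x m s c3))
    (fun s => sin (upd x m s c2) * sin (upd x m s c3)) (x m) f' g'
    (open_dom rs X) Hw ltac:(discriminate) Hd' Hf Hg).
  cbv beta; rewrite <- Ex, upd_id; exact (fun h => h). }
assert (C1 : forall m, m = c0 \/ m = c1 ->
  is_pd m (fun y => w (trans y)) x (pd m w (trans x))).
{ intros m Hm; generalize (smooth_is_pd (dom rs X) w m (trans x) Hw Hd).
  unfold is_pd; replace (trans x m) with (x m)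
    by (destruct Hm as [-> | ->]; reflexivity).
  apply is_derive_ext; intro s; f_equal; apply functional_extensionality.
  destruct Hm as [-> | ->]; intros []; reflexivity. }
destruct n.
- replace (_ + _) with (pd c0 w (trans x)) by ring; apply C1; auto.
- replace (_ + _) with (pd c1 w (trans x)) by ring; apply C1; auto.
- rewrite !Rmult_0_r, !Rplus_0_l; apply C2; auto;
    unfold is_pd, upd; cbn; auto_derive; trivial; ring.
- rewrite !Rmult_0_r, !Rplus_0_l; apply C2; auto;
    unfold is_pd, upd; cbn; auto_derive; trivial; ring.
Qed.

Lemma open_hemisphere rs X : open (fun x => dom rs BL x /\ hemisphere X x).
Proof.
apply open_and; [apply open_dom|].
assert (H : forall x : vec, continuous (fun y : vec => cos (y c2)) x)
  by (intro x; apply (elementary_continuous (fun _ => True)); [elementary|exact I]).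
destruct X; cbn.
- apply open_false.
- apply (open_comp (fun y : vec => cos (y c2)) (fun s => 0 < s));
    [intros; apply H|apply open_gt].
- apply (open_comp (fun y : vec => cos (y c2)) (fun s => s < 0));
    [intros; apply H|apply open_lt].
Qed.

Lemma pd_pd_comp_trans rs X w m n x : smooth (dom rs X) w ->
  dom rs BL x -> hemisphere X x ->
  pd m (pd n (fun y => w (trans y))) x =
  sumR (fun k =>
    sumR (fun l => pd l (pd k w) (trans x) * pd m (fun y => trans y l) x)
      * pd n (fun y => trans y k) x
    + pd k w (trans x) * pd m (pd n (fun y => trans y k)) x).
Proof.
intros Hw Hx H; apply is_pd_unique.
apply (is_pd_ext_loc m (fun y =>
  sumR (fun k => pd k w (trans y) * pd n (fun z => trans z k) y))).
- apply (open_imp_locally (fun x => dom rs BL x /\ hemisphere X x));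
    [apply open_hemisphere|easy|].
  intros y [Hy Hy']; symmetry; apply is_pd_unique; now apply (pd_comp_trans rs X).
- assert (D : forall k,
    is_pd m (fun y => pd k w (trans y) * pd n (fun z => trans z k) y) x
    (sumR (fun l => pd l (pd k w) (trans x) * pd m (fun y => trans y l) x)
      * pd n (fun y => trans y k) x
    + pd k w (trans x) * pd m (pd n (fun y => trans y k)) x)).
  { intro k; apply (is_pd_mult m (fun y => pd k w (trans y))
      (pd n (fun z => trans z k))).
    - apply (pd_comp_trans rs X (pd k w)); trivial; now apply smooth_pd.
    - apply (smooth_is_pd (fun _ => True)); [|exact I].
      apply smooth_pd, elementary_smooth; [apply open_true|].
      unfold trans; destruct k; elementary. }
  exact (is_pd_sumR m _ x _ D).
Qed.


(** Reduces the comparison of two charts to two checks on the coordinate functions: the form on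
    their differentials, and the operator on the functions themselves. *)
Lemma chart_opR_comp rs c X w x : smooth (dom rs X) w ->
  dom rs BL x -> hemisphere X x ->
  chart_opR rs c BL (fun y => w (trans y)) x =
  sumR (fun l => sumR (fun k =>
    chart_form rs c BL x (fun m => pd m (fun y => trans y l) x)
      (fun n => pd n (fun y => trans y k) x) * pd l (pd k w) (trans x)))
  + sumR (fun k => chart_opR rs c BL (fun y => trans y k) x * pd k w (trans x)).
Proof.
intros Hw Hx H.
transitivity (sumR (fun m => sumR (fun n => chart_coef2 rs c BL m n x *
    sumR (fun k => sumR (fun l => pd l (pd k w) (trans x)
                                  * pd m (fun y => trans y l) x)
                   * pd n (fun y => trans y k) x
      + pd k w (trans x) * pd m (pd n (fun y => trans y k)) x)))
  + sumR (fun m => chart_coef1 rs BL m x *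
      sumR (fun k => pd k w (trans x) * pd m (fun y => trans y k) x))).
- unfold chart_opR; f_equal; apply sumR_ext; intro m.
  + apply sumR_ext; intro n; f_equal; now apply (pd_pd_comp_trans rs X).
  + f_equal; now apply is_pd_unique, (pd_comp_trans rs X).
- etransitivity; [apply (second_order_chain (fun m n => chart_coef2 rs c BL m n x)
    (fun m => chart_coef1 rs BL m x) (fun k m => pd m (fun y => trans y k) x)
    (fun k l => pd k (pd l w) (trans x)))|].
  f_equal; apply sumR_ext; intro k.
  apply sumR_ext; intro l; f_equal; apply chart_form_sum.
Qed.

(** The differentials of [t], [r], [omega_x], [omega_y]. They pull back to the standard basis in a
    polar chart, and to the rows of the Jacobian of [trans] in [BL]. *)
Definition coord_form (k : coord) : amb -> R := fun i =>
  match k, i with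
  | c0, At | c1, Ar | c2, Ax | c3, Ay => 1
  | _, _ => 0
  end.

Lemma pull_coord_form_BL x k : pull BL x (coord_form k) =
  fun m => pd m (fun y => trans y k) x.
Proof.
rewrite pull_BL; apply functional_extensionality; intro m; rewrite pd_trans.
destruct k, m; cbn; ring.
Qed.

Lemma pull_coord_form_pole rs X x k : X <> BL -> dom rs X x ->
  pull X x (coord_form k) = delta k.
Proof.
intros HX Hx; rewrite (pull_pole rs) by trivial.
apply functional_extensionality; intro m; unfold delta.
destruct k, m; cbn; ring.
Qed.

(** By [pull_form] both sides are [amb_form] of the same ambient covectors at the same point. *)
Lemma chart_coef2_trans rs c X x l k : 0 < c -> dom rs BL x -> hemisphere X x ->
  chart_form rs c BL x (fun m => pd m (fun y => trans y l) x)
    (fun n => pd n (fun y => trans y k) x) = chart_coef2 rs c X l k (trans x).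
Proof.
intros Hc Hx H; assert (Hd := dom_trans rs X x Hx H).
assert (HX : X <> BL) by (intros ->; exact H).
unfold chart_coef2; rewrite <- !pull_coord_form_BL.
rewrite <- !(pull_coord_form_pole rs X (trans x)) by trivial.
rewrite !pull_form, par_trans; trivial.
Qed.

Lemma pd_pd_trans m n k x : pd m (pd n (fun y => trans y k)) x =
  match k, m, n with
  | c2, c2, c2 | c2, c3, c3 => - (sin (x c2) * cos (x c3))
  | c2, c2, c3 | c2, c3, c2 => - (cos (x c2) * sin (x c3))
  | c3, c2, c2 | c3, c3, c3 => - (sin (x c2) * sin (x c3))
  | c3, c2, c3 | c3, c3, c2 => cos (x c2) * cos (x c3)
  | _, _, _ => 0
  end.
Proof.
replace (pd n (fun y => trans y k)) with (fun y : vec => pd n (fun z => trans z k) y)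
  by reflexivity.
unfold pd at 1; erewrite Derive_ext by (intro s; apply pd_trans).
unfold upd; destruct k, m, n; cbn; derive_explicit; ring.
Qed.

Lemma chart_coef1_trans rs c X x k : 0 < c -> dom rs BL x -> hemisphere X x ->
  chart_opR rs c BL (fun y => trans y k) x = chart_coef1 rs X k (trans x).
Proof.
intros Hc Hx H; assert (Hs := dom_BL_sin rs x Hx).
apply dom_iff in Hx; destruct Hx as [HS _].
assert (Hk : forall k, chart_coef1 rs X k (trans x) = / Sigma rs (par BL x) *
  match k with
  | c0 => 0
  | c1 => Delta rs (par BL x) * (2 * x c1 - rs)
  | _ => ((spin rs)^2 - 2 * Delta rs (par BL x)) * trans x k
  end).
{ intro k'; unfold chart_coef1; rewrite par_trans by trivial.
  now destruct X, k'. }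
rewrite Hk; unfold chart_opR, sumR; rewrite !pd_pd_trans, !pd_trans.
unfold chart_coef2, chart_form, chart_W, chart_E, chart_sphere, chart_sin2,
  chart_phi, delta, chart_coef1.
assert (E : cos (x c2) * cos (x c2) = 1 - sin (x c2) * sin (x c2))
  by (generalize (sin2_cos2 (x c2)); unfold Rsqr; lra).
destruct k; cbn -[par]; field [E]; repeat split; lra || trivial.
Qed.

Lemma chart_opR_trans rs c X w x : 0 < c -> smooth (dom rs X) w ->
  dom rs BL x -> hemisphere X x ->
  chart_opR rs c BL (fun y => w (trans y)) x = chart_opR rs c X w (trans x).
Proof.
intros Hc Hw Hx H; rewrite (chart_opR_comp rs c X) by trivial.
unfold chart_opR at 2; f_equal; apply sumR_ext; intro l.
- apply sumR_ext; intro k; f_equal; now apply chart_coef2_trans.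
- f_equal; now apply chart_coef1_trans.
Qed.

(** * Extension across the horizon and the axis *)

Lemma polar_angle s t : s * s + t * t = 1 -> exists phi, cos phi = s /\ sin phi = t.
Proof.
intro H; assert (Hs : -1 <= s <= 1) by nra.
assert (E : sqrt (1 - s * s) = Rabs t)
  by (replace (1 - s * s) with (Rsqr t) by (unfold Rsqr; lra); apply sqrt_Rsqr_abs).
destruct (Rle_lt_dec 0 t) as [Ht|Ht]; [exists (acos s)|exists (- acos s)];
  rewrite ?cos_neg, ?sin_neg, cos_acos, sin_acos by trivial; unfold Rsqr;
  rewrite E; split; trivial.
- now apply Rabs_pos_eq.
- rewrite Rabs_left by trivial; ring.
Qed.

(** The condition on [y c2] makes the distance [rho] from the axis positive. Then [theta] is
    [asin rho] in the north and [PI - asin rho] in the south. *)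
Lemma trans_surj rs X y : X <> BL -> dom rs X y -> y c2 <> 0 ->
  exists x, dom rs BL x /\ hemisphere X x /\ trans x = y.
Proof.
intros HX Hy Hn; assert (Hy' := Hy); apply dom_iff in Hy'; destruct Hy' as [HS Hd].
assert (Hd' : y c2 * y c2 + y c3 * y c3 < 1) by (destruct X; [easy|cbn in Hd; lra..]).
set (rho := sqrt (y c2 * y c2 + y c3 * y c3)).
assert (Hpos : 0 < y c2 * y c2 + y c3 * y c3) by nra.
assert (Hrho : 0 < rho) by now apply sqrt_lt_R0.
assert (Erho : rho * rho = y c2 * y c2 + y c3 * y c3) by (apply sqrt_sqrt; lra).
destruct (polar_angle (y c2 / rho) (y c3 / rho)) as [phi [Hcos Hsin]].
{ transitivity ((y c2 * y c2 + y c3 * y c3) / (rho * rho)); [field; lra|].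
  rewrite Erho; field; lra. }
assert (Hth : exists th, 0 < th < PI /\ sin th = rho /\
  match X with South => cos th < 0 | _ => 0 < cos th end).
{ assert (Hr : -1 <= rho <= 1) by nra.
  assert (Hc : 0 < cos (asin rho))
    by (rewrite cos_asin by trivial; apply sqrt_lt_R0; unfold Rsqr; lra).
  assert (Hb := asin_bound rho); assert (HP := PI_RGT_0).
  assert (H0 : 0 < asin rho).
  { apply Rnot_le_lt; intro H0; apply sin_incr_1 in H0; try lra.
    rewrite sin_0, sin_asin in H0; lra. }
  destruct X; [easy|exists (asin rho)|exists (PI - asin rho)].
  - rewrite sin_asin by trivial; repeat split; lra.
  - rewrite sin_PI_x, sin_asin, Rtrigo_facts.cos_pi_minus by trivial.
    repeat split; lra. }
destruct Hth as [th [Hth [Hs Hcth]]].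
set (x := fun m => match m with c2 => th | c3 => phi | _ => y m end : R).
assert (Et : trans x = y).
{ apply functional_extensionality; intros []; cbn; trivial;
    rewrite Hs, ?Hcos, ?Hsin; field; lra. }
assert (Hh : hemisphere X x) by (destruct X; easy).
exists x; repeat split; trivial; try apply Hth;
  rewrite <- (par_trans X x Hh), Et; apply Hy.
Qed.

(** In a polar chart [y c2 = 0] contains the axis, and in [BL] it lies outside the domain. Excluding
    it is a single-coordinate condition that still leaves a dense set. *)
Lemma locally_generic rs x (Q : vec -> Prop) : locally x Q ->
  exists y, Q y /\ y c1 <> rs / 2 /\ y c2 <> 0.
Proof.
intros [eps H].
(* Only a coordinate that has the forbidden value is moved, by half the radius of the ball. *)
exists (fun m => match m with
  | c1 => if Req_EM_T (x c1) (rs / 2) then x c1 + eps / 2 else x c1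
  | c2 => if Req_EM_T (x c2) 0 then x c2 + eps / 2 else x c2
  | _ => x m end).
assert (He := cond_pos eps).
assert (B : forall s : R, ball s eps (s + eps / 2)).
{ intro s; change (Rabs (s + eps / 2 - s) < eps).
  replace (s + eps / 2 - s) with (eps / 2) by ring; rewrite Rabs_pos_eq; lra. }
split; [apply H; intros []; try apply ball_center|].
- destruct (Req_EM_T (x c1) (rs / 2)); [apply B|apply ball_center].
- destruct (Req_EM_T (x c2) 0); [apply B|apply ball_center].
- destruct (Req_EM_T (x c1) (rs / 2)), (Req_EM_T (x c2) 0); split; lra.
Qed.

Lemma Delta_square rs q : Delta rs q = (q Ar - rs / 2)^2.
Proof. unfold Delta, spin; field. Qed.

Lemma chart_opR_ext_loc rs c X U f g x : open U -> U x ->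
  (forall y, U y -> f y = g y) -> chart_opR rs c X f x = chart_opR rs c X g x.
Proof.
intros HU Hx E.
assert (E1 : forall n y, U y -> pd n f y = pd n g y)
  by (intros n y Hy; apply pd_ext_loc; now apply (open_imp_locally U)).
unfold chart_opR; f_equal; apply sumR_ext; intro m.
- apply sumR_ext; intro n; f_equal; apply pd_ext_loc.
  apply (open_imp_locally U); auto.
- f_equal; auto.
Qed.

Section Extension.
Variables (rs c : R) (kappa : point -> C) (P : operator).
Hypotheses (Hc : 0 < c) (Hkappa : smoothM rs kappa)
  (HP : is_Delta_box_plus rs c kappa P).

Let agree X u x : Prop :=
  P u (par X x) = apply_diffop (chart_op rs c kappa X) (fun y => u (par X y)) x.

Lemma agree_BL u x : smoothM rs u -> dom rs BL x -> x c1 <> rs / 2 -> agree BL u x.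
Proof.
intros Hu Hx Hr; destruct (HP u Hu) as [_ E].
assert (HD : Delta rs (par BL x) <> 0)
  by (rewrite Delta_square; apply pow_nonzero; cbn; lra).
unfold agree; rewrite (E x Hx HD), chart_op_apply, box_eq.
rewrite <- !boxR_eq by (trivial; apply (Hu BL)).
apply injective_projections; cbn; ring.
Qed.

Lemma agree_pole X u y : X <> BL -> smoothM rs u -> dom rs X y ->
  y c1 <> rs / 2 -> y c2 <> 0 -> agree X u y.
Proof.
intros HX Hu Hy Hr Hn; destruct (trans_surj rs X y) as [x [Hx [Hh Ht]]]; trivial.
unfold agree; rewrite <- Ht, par_trans by trivial.
rewrite agree_BL by (trivial; now rewrite <- Ht in Hr).
rewrite !chart_op_apply, par_trans by trivial.
assert (Eop : forall w : C -> R,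
  (forall X', smooth (dom rs X') (fun y => w (u (par X' y)))) ->
  chart_opR rs c BL (fun y => w (u (par BL y))) x =
  chart_opR rs c X (fun y => w (u (par X y))) (trans x)).
{ intros w Hw; rewrite <- chart_opR_trans by easy.
  apply (chart_opR_ext_loc _ _ _ _ _ _ _ (open_hemisphere rs X)); [easy|].
  intros z [_ Hz]; now rewrite par_trans. }
now rewrite !Eop by apply Hu.
Qed.

(** Both sides are continuous in the chart, [P u] because it is smooth on [M], and they agree at
    generic points; [eq0_dense] is applied to the real and imaginary parts of the difference. *)
Lemma chart_op_local X : local_expr rs P X (chart_op rs c kappa X).
Proof.
split; [now apply chart_op_smooth|].
intros u Hu x Hx; destruct (HP u Hu) as [HPu _].
assert (Hgen : forall F : vec -> R, elementary (dom rs X) F ->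
  (forall y, agree X u y -> F y = 0) -> F x = 0).
{ intros F HF HF0; apply eq0_dense; [now apply (elementary_continuous (dom rs X))|].
  intros Q HQ; destruct (locally_generic rs x (fun y => Q y /\ dom rs X y))
    as [y [[HQy Hy] [Hr Hn]]].
  - apply filter_and; [exact HQ|exact (open_dom rs X x Hx)].
  - exists y; split; trivial; apply HF0.
    destruct X; [now apply agree_BL|now apply agree_pole..]. }
assert (Hsm : forall v, smoothM rs v ->
  elementary (dom rs X) (fun y => Re (v (par X y))) /\
  elementary (dom rs X) (fun y => Im (v (par X y))))
  by (intros v Hv; split; apply el_smooth, Hv).
destruct (Hsm _ HPu), (Hsm _ Hu), (Hsm _ Hkappa).
rewrite chart_op_apply; apply injective_projections; apply Rminus_diag_uniq.
- refine (eq_trans _ (Hgen (fun y => Re (P u (par X y)) -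
    (chart_opR rs c X (fun y => Re (u (par X y))) y
     + (Re (kappa (par X y)) * Re (u (par X y))
        - Im (kappa (par X y)) * Im (u (par X y))))) _ _)).
  + unfold Re, Im; cbn; ring.
  + elementary_using ltac:(assumption || apply elementary_opR, Hu).
  + intros y E; unfold agree in E; rewrite E, chart_op_apply; unfold Re, Im; cbn; ring.
- refine (eq_trans _ (Hgen (fun y => Im (P u (par X y)) -
    (chart_opR rs c X (fun y => Im (u (par X y))) y
     + (Re (kappa (par X y)) * Im (u (par X y))
        + Im (kappa (par X y)) * Re (u (par X y))))) _ _)).
  + unfold Re, Im; cbn; ring.
  + elementary_using ltac:(assumption || apply elementary_opR, Hu).
  + intros y E; unfold agree in E; rewrite E, chart_op_apply; unfold Re, Im; cbn; ring.
Qed.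
End Extension.

(** * Independence of the symbol from the local expression *)

Lemma pdC_RtoC m f x : pdC m (fun y => RtoC (f y)) x = RtoC (pd m f x).
Proof. apply injective_projections; [reflexivity|exact (Derive_const 0 (x m))]. Qed.

Lemma apply_diffop_RtoC L f x : apply_diffop L (fun y => RtoC (f y)) x =
  (sumC (fun m => sumC (fun n => coef2 L m n x * RtoC (pd m (pd n f) x)))
   + sumC (fun m => coef1 L m x * RtoC (pd m f x)) + coef0 L x * RtoC (f x))%C.
Proof.
unfold apply_diffop.
assert (E : forall n, pdC n (fun y => RtoC (f y)) = fun y => RtoC (pd n f y))
  by (intro n; apply functional_extensionality; intro; apply pdC_RtoC).
assert (E' : forall m n,
  pdC m (pdC n (fun y => RtoC (f y))) x = RtoC (pd m (pd n f) x))
  by (intros m n; rewrite E; apply pdC_RtoC).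
unfold sumC; now rewrite !E', !pdC_RtoC.
Qed.

(* The second-order part of L, polarized: the defect in the Leibniz rule. *)
Definition polar2 (L : diffop) (x p q : vec) : C :=
  sumC (fun m => sumC (fun n =>
    coef2 L m n x * RtoC (p m * q n + p n * q m)))%C.

(** The derivatives that fall on a single factor match by the product rule. The two products each
    contribute [coef0 * g * h], and the term with [1] takes one of them back. *)
Lemma leibniz L U g h x : open U -> smooth U g -> smooth U h -> U x ->
  apply_diffop L (fun y => RtoC (g y * h y)) x =
  (RtoC (g x) * apply_diffop L (fun y => RtoC (h y)) x
   + RtoC (h x) * apply_diffop L (fun y => RtoC (g y)) x
   - RtoC (g x * h x) * apply_diffop L (fun _ => RtoC 1) x
   + polar2 L x (fun m => pd m g x) (fun m => pd m h x))%C.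
Proof.
intros HU Hg Hh Hx.
assert (E : forall f m y, smooth U f -> U y -> is_pd m f y (pd m f y))
  by (intros; now apply (smooth_is_pd U)).
assert (E1 : forall m y, U y ->
  pd m (fun y => g y * h y) y = pd m g y * h y + g y * pd m h y)
  by (intros; apply pd_mult; auto).
assert (E2 : forall m n, pd m (pd n (fun y => g y * h y)) x =
  pd m (pd n g) x * h x + pd n g x * pd m h x
  + (pd m g x * pd n h x + g x * pd m (pd n h) x)).
{ intros m n; apply is_pd_unique.
  apply (is_pd_ext_loc m (fun y => pd n g y * h y + g y * pd n h y)).
  - apply (open_imp_locally U); trivial; intros; symmetry; auto.
  - apply is_pd_plus; apply is_pd_mult; auto using smooth_pd. }
assert (E0 : forall a m y, pd m (fun _ => a) y = 0)
  by (intros; apply is_pd_unique, is_pd_const).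
assert (E00 : forall m n, pd m (pd n (fun _ => 1)) x = 0).
{ intros m n; replace (pd n (fun _ => 1)) with (fun _ : vec => 0);
    [apply E0|]; apply functional_extensionality; intro; now rewrite E0. }
change (fun _ : vec => RtoC 1) with (fun y : vec => RtoC ((fun _ => 1) y)).
rewrite !apply_diffop_RtoC; unfold polar2, sumC.
rewrite !E2, !E1, !E00, !E0 by trivial.
rewrite !RtoC_plus, !RtoC_mult.
ring.
Qed.

Definition lin (e : amb -> R) (q : point) : R :=
  e At * q At + e Ar * q Ar + e Ax * q Ax + e Ay * q Ay + e Az * q Az.

Lemma smooth_lin rs e X : smooth (dom rs X) (fun x => lin e (par X x)).
Proof.
apply elementary_smooth; [apply open_dom|].
unfold lin; elementary_using ltac:(apply elementary_par).
Qed.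

Lemma pd_lin rs X e m x : dom rs X x ->
  pd m (fun y => lin e (par X y)) x = pull X x e m.
Proof.
intro Hx; apply is_pd_unique; unfold lin, pull.
assert (D : forall i, is_pd m (fun y => e i * par X y i) x
  (e i * pd m (fun y => par X y i) x)).
{ intro i; replace (e i * _) with
    (0 * par X x i + e i * pd m (fun y => par X y i) x) by ring.
  apply (is_pd_mult m (fun _ => e i)); [apply is_pd_const|].
  destruct (elementary_pd (dom rs X) _ m (elementary_par rs X i)) as [f [_ Df]].
  specialize (Df x Hx); now rewrite (is_pd_unique _ _ _ _ Df). }
repeat apply is_pd_plus; apply D.
Qed.

Lemma smoothM_RtoC rs f : (forall X, smooth (dom rs X) (fun x => f (par X x))) ->
  smoothM rs (fun q => RtoC (f q)).
Proof.
intros H X; split; [apply H|].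
apply elementary_smooth; [apply open_dom|exact (el_const _ 0)].
Qed.

(* Testing P on products of linear functions recovers the symbol of any of its
   local expressions. *)
Lemma polar2_local_expr rs P X L L' x e e' :
  local_expr rs P X L -> local_expr rs P X L' -> dom rs X x ->
  polar2 L x (pull X x e) (pull X x e') = polar2 L' x (pull X x e) (pull X x e').
Proof.
intros HL HL' Hx.
set (g := fun y => lin e (par X y)); set (h := fun y => lin e' (par X y)).
assert (Hpull : forall K, polar2 K x (pull X x e) (pull X x e') =
  polar2 K x (fun m => pd m g x) (fun m => pd m h x)).
{ intro K; f_equal; apply functional_extensionality; intro m; symmetry;
    now apply (pd_lin rs). }
assert (Happ : forall f : point -> R,
  (forall Y, smooth (dom rs Y) (fun y => f (par Y y))) ->
  apply_diffop L (fun y => RtoC (f (par X y))) x =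
  apply_diffop L' (fun y => RtoC (f (par X y))) x).
{ intros f Hf; apply smoothM_RtoC in Hf.
  now rewrite <- (proj2 HL _ Hf x Hx), <- (proj2 HL' _ Hf x Hx). }
assert (Hleib := fun K => leibniz K (dom rs X) g h x (open_dom rs X)
  (smooth_lin rs e X) (smooth_lin rs e' X) Hx).
assert (H1 := Happ (fun _ => 1) ltac:(intro; apply elementary_smooth;
  [apply open_dom|apply el_const])).
assert (Hg := Happ (lin e) (smooth_lin rs e)).
assert (Hh := Happ (lin e') (smooth_lin rs e')).
assert (Hgh := Happ (fun q => lin e q * lin e' q) ltac:(intro; apply elementary_smooth;
  [apply open_dom|apply el_mult; apply el_smooth, smooth_lin])).
cbv beta in *; fold g in Hg; fold h in Hh.
change (apply_diffop L (fun y => RtoC (g y * h y)) x =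
  apply_diffop L' (fun y => RtoC (g y * h y)) x) in Hgh.
rewrite !Hleib in Hgh; rewrite !Hpull.
change (apply_diffop L (fun y => RtoC (g y)) x =
  apply_diffop L' (fun y => RtoC (g y)) x) in Hg.
change (apply_diffop L (fun y => RtoC (h y)) x =
  apply_diffop L' (fun y => RtoC (h y)) x) in Hh.
rewrite H1, Hg, Hh in Hgh.
revert Hgh; generalize (polar2 L x (fun m => pd m g x) (fun m => pd m h x)).
generalize (polar2 L' x (fun m => pd m g x) (fun m => pd m h x)).
intros u v Huv; replace v with
  ((RtoC (g x) * apply_diffop L' (fun y => RtoC (h y)) x
   + RtoC (h x) * apply_diffop L' (fun y => RtoC (g y)) x
   - RtoC (g x * h x) * apply_diffop L' (fun _ => RtoC 1) x + v)
   - (RtoC (g x) * apply_diffop L' (fun y => RtoC (h y)) x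
   + RtoC (h x) * apply_diffop L' (fun y => RtoC (g y)) x
   - RtoC (g x * h x) * apply_diffop L' (fun _ => RtoC 1) x))%C by ring.
rewrite Huv; ring.
Qed.

Lemma chart_form_sym rs c X x p q : chart_form rs c X x p q = chart_form rs c X x q p.
Proof.
unfold chart_form, chart_E; replace (chart_sphere X x p q)
  with (chart_sphere X x q p) by (destruct X; cbn; ring); ring.
Qed.

Lemma sumC_RtoC f : sumC (fun m => RtoC (f m)) = RtoC (sumR f).
Proof. unfold sumC, sumR; now rewrite !RtoC_plus. Qed.

Lemma sumC_ext f g : (forall i, f i = g i) -> sumC f = sumC g.
Proof. intro H; unfold sumC; now rewrite !H. Qed.

Lemma polar2_chart_op rs c kappa X x p q :
  polar2 (chart_op rs c kappa X) x p q = RtoC (2 * chart_form rs c X x p q).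
Proof.
transitivity (sumC (fun m => sumC (fun n =>
  RtoC (chart_coef2 rs c X m n x * (p m * q n + p n * q m))))).
- unfold polar2; apply sumC_ext; intro m; apply sumC_ext; intro n.
  symmetry; apply RtoC_mult.
- transitivity (sumC (fun m => RtoC (sumR (fun n =>
    chart_coef2 rs c X m n x * (p m * q n + p n * q m))))).
  + apply sumC_ext; intro; apply sumC_RtoC.
  + rewrite sumC_RtoC; f_equal.
    replace (2 * chart_form rs c X x p q)
      with (chart_form rs c X x p q + chart_form rs c X x q p)
      by (rewrite (chart_form_sym rs c X x q p); ring).
    rewrite <- !chart_form_sum; unfold sumR; ring.
Qed.

Lemma polar2_amb_form rs c kappa P X L x e e' : 0 < c -> smoothM rs kappa ->
  is_Delta_box_plus rs c kappa P -> local_expr rs P X L -> dom rs X x ->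
  polar2 L x (pull X x e) (pull X x e') = RtoC (2 * amb_form rs c (par X x) e e').
Proof.
intros Hc Hk HP HL Hx; rewrite <- pull_form by trivial.
rewrite <- (polar2_chart_op rs c kappa).
apply (polar2_local_expr rs P); trivial; now apply chart_op_local.
Qed.

Definition quad (A : coord -> coord -> R) (p : vec) : R :=
  sumR (fun m => sumR (fun n => A m n * (p m * p n))).

Lemma pd_quad A k p : pd k (quad A) p =
  sumR (fun m => sumR (fun n => A m n * (delta k m * p n + p m * delta k n))).
Proof.
apply is_pd_unique; apply is_pd_sumR; intro m; apply is_pd_sumR; intro n.
replace (A m n * (delta k m * p n + p m * delta k n))
  with (0 * (p m * p n) + A m n * (delta k m * p n + p m * delta k n)) by ring.
apply (is_pd_mult k (fun _ => A m n)); [apply is_pd_const|].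
apply is_pd_mult; apply is_pd_proj.
Qed.

Lemma symbol_quad L x p : principal_symbol L x p =
  (- quad (fun m n => Re (coef2 L m n x)) p,
   - quad (fun m n => Im (coef2 L m n x)) p).
Proof.
unfold principal_symbol, sumC, quad, sumR.
apply injective_projections; unfold Re, Im; cbn; ring.
Qed.

(** The derivative of a quadratic form in the direction [q] is its polarization; the sign is
    [Ci * Ci]. A vanishing differential in [p] thus puts [p] in the kernel of the form. *)
Lemma euler L x p q :
  sumC (fun k => RtoC (q k) * pdC k (fun y => principal_symbol L x y) p)%C =
  (- polar2 L x q p)%C.
Proof.
assert (E : forall k, pdC k (fun y => principal_symbol L x y) p =
  (- pd k (quad (fun m n => Re (coef2 L m n x))) p,
   - pd k (quad (fun m n => Im (coef2 L m n x))) p)).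
{ intro k; unfold pdC, pd; apply injective_projections; cbn [fst snd];
  rewrite <- Derive_opp; apply Derive_ext; intro s; now rewrite symbol_quad. }
unfold sumC at 1; rewrite !E, !pd_quad.
unfold polar2, sumC, sumR, delta.
apply injective_projections; unfold Re, Im; cbn; ring.
Qed.

(** * Double characteristic points *)

(** At [r = a] one has [rs r = 2 a^2] and [Sigma = a^2 (2 - sin2)], and the denominator of [Psi]
    becomes [4 a^2 / (2 - sin2)]. The dependence on [theta] cancels, leaving [Psi = c p_phi / rs];
    the factor [rs^2 / 2] is [r^2 + a^2]. *)
Lemma amb_W_horizon rs c l : 0 < rs -> in_M rs (base l) -> base l Ar = rs / 2 ->
  amb_W rs c (base l) (mom l) = rs^2 / 2 * (mom l At + Psi rs c l).
Proof.
intros Hrs [HS _] Hr.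
assert (E : base l Az ^ 2 = 1 - sin2 (base l)) by (unfold cos2 in HS; lra).
unfold amb_W, Psi, Sigma, cos2, spin; rewrite Hr, E.
change (amb_phi (base l) (mom l)) with (p_phi l).
assert (H2 : 0 <= sin2 (base l) <= 1)
  by (generalize (pow2_ge_0 (base l Ax)) (pow2_ge_0 (base l Ay))
    (pow2_ge_0 (base l Az)); unfold sin2 in *; lra).
clear E HS; field.
assert (H3 := pow_lt rs 2 Hrs); split.
- assert (0 <= rs^2 * (1 - sin2 (base l))) by (apply Rmult_le_pos; lra); lra.
- replace (_ + _) with (8 * (rs^2 * rs^2)) by ring; nra.
Qed.

Lemma amb_form_horizon rs c q e : 0 < c -> in_M rs q -> q Ar = rs / 2 ->
  amb_form rs c q e e = 0 -> amb_W rs c q e = 0.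
Proof.
intros Hc [_ HS] Hr; unfold amb_form; rewrite Delta_square, Hr; intro H.
apply Rsqr_0_uniq; unfold Rsqr.
transitivity (- c^2 * Sigma rs q * 0); [rewrite <- H; field; split; lra|ring].
Qed.

Lemma amb_form_sym rs c q e e' : amb_form rs c q e e' = amb_form rs c q e' e.
Proof. unfold amb_form, dot3; ring. Qed.

Definition amb_basis (i j : amb) : R :=
  match i, j with
  | At, At | Ar, Ar | Ax, Ax | Ay, Ay | Az, Az => 1
  | _, _ => 0
  end.

(** Testing on the ambient basis gives a linear system with [Delta] and [Sigma] invertible. It is
    solved for [w] first, which stands for [amb_W q e], then for [e At], and last for the other
    components. *)
Lemma amb_form_nondegenerate rs c q e : 0 < c -> in_M rs q -> q Ar <> rs / 2 ->
  dot3 q e = 0 -> (forall e', amb_form rs c q e e' = 0) -> forall i, e i = 0.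
Proof.
intros Hc [HM HS] Hr Hq H.
assert (HD : Delta rs q <> 0) by (rewrite Delta_square; apply pow_nonzero; lra).
assert (H' : forall e', - / c^2 * amb_W rs c q e * amb_W rs c q e'
  + Delta rs q * ((spin rs)^2 * sin2 q * / c^2 * e At * e' At
    + spin rs * / c * (e At * amb_phi q e' + e' At * amb_phi q e)
    + dot3 e e' + Delta rs q * e Ar * e' Ar) = 0).
{ intro e'; specialize (H e'); unfold amb_form in H; rewrite Hq in H.
  apply Rmult_integral in H; destruct H as [H|H].
  - now apply Rinv_neq_0_compat in H.
  - rewrite <- H; ring. }
assert (Ht := H' (amb_basis At)); assert (H1 := H' (amb_basis Ar)).
assert (Hx := H' (amb_basis Ax)); assert (Hy := H' (amb_basis Ay)).
assert (Hz := H' (amb_basis Az)); clear H H'.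
unfold dot3, amb_W, amb_phi, amb_basis in Ht, H1, Hx, Hy, Hz.
rewrite !Rmult_0_r, !Rmult_1_r in *.
set (a := spin rs) in *; set (D := Delta rs q) in *.
set (w := (q Ar ^ 2 + a ^ 2) * e At + a * c * (q Ax * e Ay - q Ay * e Ax)) in *.
assert (HSE : Sigma rs q = q Ar ^ 2 + a^2 - a^2 * sin2 q)
  by (unfold Sigma; fold a; replace (cos2 q) with (1 - sin2 q) by lra; ring).
assert (Hx' : e Ax * D = a / c * q Ay * (D * e At - w)).
{ apply Rminus_diag_uniq; rewrite <- Hx; field; lra. }
assert (Hy' : e Ay * D = - (a / c * q Ax * (D * e At - w))).
{ apply Rminus_diag_uniq; rewrite <- Hy; field; lra. }
assert (HPhi : (q Ax * e Ay - q Ay * e Ax) * D = - (a / c * sin2 q * (D * e At - w))).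
{ transitivity (q Ax * (e Ay * D) - q Ay * (e Ax * D)); [ring|].
  rewrite Hx', Hy'; unfold sin2; ring. }
(* Substituting [HPhi] in the [t] equation cancels the terms in [D * e At] and leaves
   [Sigma * w = 0]. *)
assert (Hw : w = 0).
{ apply (Rmult_eq_reg_l (Sigma rs q)); [|exact HS].
  transitivity (- c^2 * 0); [rewrite <- Ht|ring].
  transitivity (w * (q Ar ^ 2 + a ^ 2) - D * a^2 * sin2 q * e At
    - a * c * ((q Ax * e Ay - q Ay * e Ax) * D)); [|field; lra].
  rewrite HPhi, HSE; field; lra. }
rewrite Hw, Rminus_0_r in Hx', Hy', HPhi.
assert (HDK : forall s t, s * D = t * D -> s = t)
  by (intros s t E; now apply (Rmult_eq_reg_r D)).
assert (HPhi' : q Ax * e Ay - q Ay * e Ax = - (a / c * sin2 q * e At))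
  by (apply HDK; rewrite HPhi; ring).
(* With this value of the [phi] component, the definition of [w] collapses to [Sigma * e At]. *)
assert (Et : e At = 0).
{ apply (Rmult_eq_reg_l (Sigma rs q)); [|exact HS].
  transitivity w; [unfold w; rewrite HPhi', HSE; field; lra|rewrite Hw; ring]. }
rewrite Hw, Et in *; intros [].
- exact Et.
- apply HDK, HDK; rewrite !Rmult_0_l, <- H1; ring.
- apply HDK; rewrite Hx'; ring.
- apply HDK; rewrite Hy'; ring.
- apply HDK; rewrite Rmult_0_l, <- Hz; ring.
Qed.

(** The sign of [omega_z] selects the chart; [BL] serves on the equator, at [theta = PI / 2]. *)
Lemma charts_cover rs q : in_M rs q -> exists X x, dom rs X x /\ q = par X x.
Proof.
intro Hq; assert (HM := proj1 Hq); unfold sin2, cos2 in HM.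
assert (K : forall X x, inner X x -> q = par X x ->
  exists X x, dom rs X x /\ q = par X x).
{ intros X x Hx E; exists X, x; split; trivial; apply dom_iff; rewrite <- E.
  split; [apply Hq|exact Hx]. }
set (x := fun m => match m with
  | c0 => q At | c1 => q Ar | c2 => q Ax | c3 => q Ay end : R).
assert (Ez : sqrt (1 - q Ax ^ 2 - q Ay ^ 2) = Rabs (q Az))
  by (rewrite <- sqrt_Rsqr_abs; f_equal; unfold Rsqr; lra).
destruct (total_order_T (q Az) 0) as [[Hz|Hz]|Hz].
- apply (K South x); [cbn; nra|].
  apply functional_extensionality; intros []; trivial; cbn -[pow]; unfold x.
  rewrite Ez, Rabs_left by trivial; ring.
- destruct (polar_angle (q Ax) (q Ay)) as [phi [Hcos Hsin]]; [rewrite Hz in HM; lra|].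
  apply (K BL (fun m => match m with
    | c0 => q At | c1 => q Ar | c2 => PI / 2 | c3 => phi end)).
  + cbn; assert (H := PI_RGT_0); lra.
  + apply functional_extensionality; intros []; trivial; cbn;
      rewrite ?cos_PI2, ?sin_PI2; lra.
- apply (K North x); [cbn; nra|].
  apply functional_extensionality; intros []; trivial; cbn -[pow]; unfold x.
  rewrite Ez, Rabs_pos_eq; lra.
Qed.

Lemma principal_symbol_chart_op rs c kappa X x p :
  principal_symbol (chart_op rs c kappa X) x p = RtoC (- chart_form rs c X x p p).
Proof.
rewrite <- chart_form_sum; unfold principal_symbol, sumC, sumR; cbn [coef2 chart_op].
apply injective_projections; cbn; ring.
Qed.

Lemma is_pd_opp m f x l : is_pd m f x l -> is_pd m (fun y => - f y) x (- l).
Proof. intro H; exact (is_derive_opp _ _ _ H). Qed.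

(* On the horizon Delta vanishes to second order and W to first order. *)
Lemma pd_chart_form_x rs c X x p m : dom rs X x -> x c1 = rs / 2 ->
  chart_W rs c X x p = 0 -> pd m (fun y => - chart_form rs c X y p p) x = 0.
Proof.
intros Hx Hr HW.
assert (HA : forall y, par X y Ar = y c1) by (destruct X; reflexivity).
destruct (elementary_pd _ _ m (elementary_inv_Sigma rs X)) as [S' [_ DS]].
destruct (elementary_pd _ _ m (elementary_W rs c X p)) as [W' [_ DW]].
destruct (elementary_pd _ _ m (elementary_E rs c X p p)) as [E' [_ DE]].
assert (HD : Delta rs (par X x) = 0)
  by (rewrite Delta_square, HA, Hr; ring).
assert (DD : is_pd m (fun y => Delta rs (par X y)) x 0).
{ apply (is_pd_ext_loc m (fun y => (y c1 - rs / 2) * (y c1 - rs / 2))).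
  - apply filter_forall; intro y; rewrite Delta_square, HA; ring.
  - assert (D1 : is_pd m (fun y => y c1 - rs / 2) x (delta m c1 + 0))
      by (apply is_pd_plus; [apply is_pd_proj|apply is_pd_const]).
    assert (D2 := is_pd_mult _ _ _ _ _ _ D1 D1); cbv beta in D2.
    rewrite Hr, Rminus_diag, Rmult_0_l, Rmult_0_r, Rplus_0_l in D2; exact D2. }
apply is_pd_unique.
evar (l : R); replace 0 with l.
- apply is_pd_opp; unfold chart_form.
  apply (is_pd_mult m (fun y => / Sigma rs (par X y))); [exact (DS x Hx)|].
  apply is_pd_plus.
  + apply is_pd_mult; [|exact (DW x Hx)].
    apply (is_pd_mult m (fun _ => - / c^2)); [apply is_pd_const|exact (DW x Hx)].
  + apply (is_pd_mult m (fun y => Delta rs (par X y))); [exact DD|].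
    apply is_pd_plus; [exact (DE x Hx)|].
    apply (is_pd_mult m (fun y => Delta rs (par X y) * p c1) (fun _ => p c1));
      [|apply is_pd_const].
    apply (is_pd_mult m _ (fun _ => p c1)); [exact DD|apply is_pd_const].
- unfold l; rewrite HD, HW; ring.
Qed.

(** Over a horizon point the form equals [- W^2 / (c^2 Sigma)] for all momenta, a multiple of the
    square of a function that vanishes at [p]. *)
Lemma pd_chart_form_p rs c X x p m : dom rs X x -> x c1 = rs / 2 ->
  chart_W rs c X x p = 0 -> pd m (fun y => - chart_form rs c X x y y) p = 0.
Proof.
intros Hx Hr HW.
assert (HD : Delta rs (par X x) = 0)
  by (rewrite Delta_square; replace (par X x Ar) with (x c1)
        by (destruct X; reflexivity); rewrite Hr; ring).
assert (HWe : elementary (fun _ => True) (fun y => chart_W rs c X x y)).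
{ unfold chart_W, chart_phi; destruct X; elementary. }
destruct (elementary_pd _ _ m HWe) as [W' [_ DW]]; specialize (DW p I).
apply is_pd_unique.
apply (is_pd_ext_loc m (fun y =>
  / Sigma rs (par X x) * / c^2 * (chart_W rs c X x y * chart_W rs c X x y))).
- apply filter_forall; intro y; unfold chart_form; rewrite HD; ring.
- evar (l : R); replace 0 with l.
  + apply (is_pd_mult m (fun _ => / Sigma rs (par X x) * / c^2));
      [apply is_pd_const|apply is_pd_mult; exact DW].
  + unfold l; rewrite HW; ring.
Qed.

Theorem lemma3p1 (rs c : R) (Hrs : 0 < rs) (Hc : 0 < c)
  (kappa : point -> C) (Hkappa : smoothM rs kappa)
  (P : operator) (HP : is_Delta_box_plus rs c kappa P) :
  forall l : covector, Sigma2 rs c l <-> double_char rs P l.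
Proof.
intro l; split.
- intros [Hl [Hr H0]]; split; trivial.
  assert (HM := proj1 (proj1 Hl)).
  destruct (charts_cover rs (base l) HM) as [X [x [Hx Eq]]].
  assert (Hr' : x c1 = rs / 2) by (rewrite <- Hr, Eq; destruct X; reflexivity).
  assert (HW : chart_W rs c X x (pull X x (mom l)) = 0)
    by (rewrite (pull_W rs), <- Eq, amb_W_horizon, H0 by trivial; ring).
  exists X, (chart_op rs c kappa X), x, (pull X x (mom l)).
  assert (HC : forall (f : vec -> C) (g : vec -> R) m y, (forall z, f z = RtoC (g z)) ->
    pd m g y = 0 -> pdC m f y = 0).
  { intros f g m y E Eg; replace f with (fun z => RtoC (g z))
      by (apply functional_extensionality; auto).
    now rewrite pdC_RtoC, Eg. }
  repeat split; try apply (chart_op_local rs c kappa P Hc Hkappa HP X); trivial;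
    try apply Hx.
  + rewrite principal_symbol_chart_op; unfold chart_form.
    rewrite HW, Delta_square, <- Eq, Hr; f_equal; ring.
  + intro m; apply (HC _ (fun y =>
      - chart_form rs c X y (pull X x (mom l)) (pull X x (mom l)))).
    * intro; apply principal_symbol_chart_op.
    * now apply pd_chart_form_x.
  + intro m; apply (HC _ (fun y => - chart_form rs c X x y y)).
    * intro; apply principal_symbol_chart_op.
    * now apply pd_chart_form_p.
- intros [Hl [X [L [x [p [HL [[Hx [Eq Hp]] [Hs [_ Hsp]]]]]]]]].
  assert (Ep : p = pull X x (mom l)) by (apply functional_extensionality; exact Hp).
  assert (HM := proj1 (proj1 Hl)).
  assert (Hpol := fun e e' => polar2_amb_form rs c kappa P X L x e e' Hc Hkappa HP HL Hx).
  rewrite <- Eq in Hpol.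
  assert (H0 : forall e', amb_form rs c (base l) (mom l) e' = 0).
  (* [Hsp] makes the left side of Euler's identity zero, so the form pairs [mom l] to zero with
     every ambient covector. *)
  { intro e'; assert (He := euler L x p (pull X x e')).
    unfold sumC at 1 in He; rewrite !Hsp, Ep, Hpol in He.
    apply (f_equal fst) in He; cbn -[amb_form] in He.
    rewrite amb_form_sym; lra. }
  assert (Hr : base l Ar = rs / 2).
  { destruct (Req_dec (base l Ar) (rs / 2)) as [|Hn]; trivial; exfalso.
    destruct Hl as [[_ Ht] [i Hi]]; apply Hi.
    apply (amb_form_nondegenerate rs c (base l)); trivial.
    unfold dot3; rewrite <- Ht; ring. }
  split; [exact Hl|split; [exact Hr|]].
  assert (HW := amb_form_horizon rs c (base l) (mom l) Hc HM Hr (H0 _)).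
  rewrite amb_W_horizon in HW by trivial.
  apply Rmult_integral in HW; destruct HW as [HW|HW]; [nra|exact HW].
Qed.
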